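(* Let $\mathcal{D}=(\mathcal{P},\mathcal{B})$ be a nontrivial $2$-$(v,k,\lambda)$ design admitting a flag-transitive, point-imprimitive group of automorphisms. Then $k\leq 2\lambda^2(\lambda-1)$ and $v\leq \left(2\lambda^2(\lambda-1)-2\right)^2$.
   Context: A $2$-$(v,k,\lambda)$ design $\mathcal{D}=(\mathcal{P},\mathcal{B})$ consists of a set $\mathcal{P}$ of $v$ points and a set $\mathcal{B}$ of $k$-subsets of $\mathcal{P}$ (blocks) such that every pair of distinct points lies in exactly $\lambda$ blocks; it is nontrivial if $2<k<v$. An automorphism is a permutation of $\mathcal{P}$ preserving $\mathcal{B}$. A flag is a pair $(\alpha,B)$ with $\alpha\in B\in\mathcal{B}$; a group $G$ of automorphisms is flag-transitive if it is transitive on flags, and point-imprimitive if it leaves invariant some partition of $\mathcal{P}$ other than the partition into singletons and the partition $\{\mathcal{P}\}$. *)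

(* Defs.v *)
From mathcomp Require Import all_boot all_order all_fingroup all_algebra all_solvable.

Set Implicit Arguments.
Unset Strict Implicit.
Unset Printing Implicit Defensive.

Section Design.

Variable T : finType.

(* The point set is the whole of T; B is a set of blocks, so there are no
   repeated blocks. *)
Definition is_2design (B : {set {set T}}) (v k lambda : nat) : Prop :=
  [/\ #|T| = v,
      forall b, b \in B -> #|b| = k
    & forall x y : T, x != y ->
        #|[set b in B | (x \in b) && (y \in b)]| = lambda].

Definition nontrivial_params (v k : nat) : Prop := 2 < k < v.

Definition design_automorphism_group (B : {set {set T}}) (G : {group {perm T}})
    : bool :=
  [acts G, on B | 'P^* ].

Definition flags (B : {set {set T}}) : {set T * {set T}} :=
  [set f | (f.2 \in B) && (f.1 \in f.2)].

Definition flag_act (f : T * {set T}) (g : {perm T}) : T * {set T} :=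
  ('P%act f.1 g, 'P^*%act f.2 g).

Lemma flag_act1 : flag_act^~ 1%g =1 id.
Proof. by case=> x b; rewrite /flag_act /fst /snd !act1. Qed.

Lemma flag_actM f : act_morph flag_act f.
Proof. by case: f => x b g h; rewrite /flag_act /fst /snd !actM. Qed.

Canonical flag_action := TotalAction flag_act1 flag_actM.

(* In MathComp transitivity on a set entails that the set is nonempty, so this
   requires at least one flag; for a 2-design it thereby excludes lambda = 0. *)
Definition flag_transitive (B : {set {set T}}) (G : {group {perm T}}) : bool :=
  [transitive G, on flags B | flag_action].

Definition point_imprimitive (G : {group {perm T}}) : Prop :=
  exists Q : {set {set T}},
    [/\ partition Q [set: T],
        [acts G, on Q | 'P^* ],
        Q != [set [set x] | x : T]
      & Q != [set [set: T]]].

Lemma point_imprimitiveP (G : {group {perm T}}) :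
  point_imprimitive G <->
  exists Q, imprimitivity_system G [set: T] 'P Q.
Proof.
split=> -[Q].
- case=> partQ actQ nsing nfull; exists Q.
  have [/eqP covQ triQ n0Q] := and3P partQ.
  have imQ : pblock Q @: [set: T] = Q.
    apply/setP=> A; apply/imsetP/idP => [[x _ ->] | QA].
      by rewrite pblock_mem // covQ inE.
    have /set0Pn[x Ax] : A != set0 by apply: contraNneq n0Q => <-.
    by exists x; rewrite ?inE // (def_pblock triQ QA Ax).
  rewrite /imprimitivity_system partQ actQ ltn_neqAle eq_sym /=.
  have leQ : #|Q| <= #|[set: T]| by rewrite -{1}imQ leq_imset_card.
  rewrite -andbA; apply/and3P; split.
  + apply: contraNneq nfull => /eqP/cards1P[A QA].
    by rewrite QA -covQ QA /cover big_set1.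
  + rewrite lt0n cards_eq0; apply: contraNneq nsing => Q0.
    rewrite Q0 eq_sym -subset0; apply/subsetP=> A /imsetP[x _ _].
    by have := in_setT x; rewrite -covQ Q0 /cover big_set0 inE.
  + rewrite ltn_neqAle leQ andbT; apply: contra nsing.
    rewrite -{1}imQ => /imset_injP injQ.
    rewrite -{1}imQ; apply/eqP/setP=> A.
    have Ex x : pblock Q x = [set x].
      apply/setP=> y; rewrite inE; apply/idP/eqP => [xy | ->].
        by apply/injQ; rewrite ?inE //; apply: same_pblock.
      by rewrite mem_pblock covQ inE.
    by apply/imsetP/imsetP => -[x _ ->]; exists x; rewrite ?inE.
- case/and3P=> partQ actQ /andP[gt1 lt]; exists Q; split=> //.
  + apply: contraTneq lt => ->.
    by rewrite card_imset ?cardsT ?ltnn //; exact: set1_inj.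
  + by apply: contraTneq gt1 => ->; rewrite cards1.
Qed.

End Design.

(* Main.v *)
(** A nonempty intersection of a block with a class has constant size [l].  With
    [c] the class size, [d] the number of classes and [x = k - 1 - d (l - 1)],
    counting gives [c x = k - l], Fisher's inequality gives
    [x (l - 1) <= lambda - 1], and reducing the number [v r / k] of blocks modulo
    [k] shows that [k] divides [lambda l (x + 1) (x + l)].  This proves the bound
    on [k] except for three parameter sets, [lambda = l = 2] with [c = d = 2 p]
    and [p = 5] or [11], and [lambda = 5], [l = 3] with [c = d = 3 * 37].  The
    bound on [v] follows from [c <= k - 2] and [d <= k - 2].

    The three sets, where [c = d = l p] with [p] prime, are excluded as follows.
    A suborbit [Y] satisfies [r | lambda |Y|], so [G] is primitive on the
    classes, and so is the stabiliser of a class on that class.  Jordan's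
    argument turns an element of order [p] that fixes some but not all classes
    into a transitive action that makes [p + 2] (if [l = 2]) or [19] (if [l = 3])
    divide the order of [G]; counting the fixed points of elements of these
    orders shows that this is impossible.  As [p ^ 2] divides [|G|], some element
    [x] of order [p] therefore fixes all classes, and moreover fixes no point and
    no block.  Comparing a block through [a] and [a^x] with its images under the
    kernel [K] of [G] on the classes gives a contradiction: the number of blocks
    through [a] in one [K]-orbit is so small that either [x] fixes a block, or the
    [2 p - 1] other points of the class of [a] fall into pairs. *)

Require Import Defs.
From mathcomp Require Import all_boot all_order all_fingroup all_algebra all_solvable.
From mathcomp Require Import zify ring.

Set Implicit Arguments.
Unset Strict Implicit.
Unset Printing Implicit Defensive.

(** * Jordan's theorem on primitive groups *)

Section Blocks.

Local Open Scope group_scope.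

Variables (aT : finGroupType) (rT : finType) (to : {action aT &-> rT}).
Implicit Types (G H : {group aT}) (A S X Y : {set rT}).

Definition is_block (G : {set aT}) X : bool :=
  [forall g in G, (to^* X g == X) || [disjoint X & to^* X g]].

Lemma is_blockP (G : {set aT}) X :
  reflect {in G, forall g, to^* X g <> X -> [disjoint X & to^* X g]}
          (is_block G X).
Proof.
apply: (iffP forall_inP) => blockX g Gg; last first.
  by case: eqVneq => //= /eqP; apply: blockX.
by move/eqP=> ne; have := blockX g Gg; rewrite (negPf ne).
Qed.

(** Primitivity on [S], kept apart from transitivity, which is assumed separately where it is
    needed. *)
Definition no_blocks (G : {set aT}) S : Prop :=
  forall X, X \subset S -> 1 < #|X| < #|S| -> ~~ is_block G X.

Lemma mem_setactE X x g : (to x g \in to^* X g) = (x \in X).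
Proof.
rewrite setactE; apply/imsetP/idP => [[y Xy /act_inj ->] // | Xx].
by exists x.
Qed.

Lemma mem_setactV X x g : (x \in to^* X g) = (to x g^-1 \in X).
Proof. by rewrite -{1}(actKV to g x) mem_setactE. Qed.

Lemma setactI X Y g : to^* (X :&: Y) g = to^* X g :&: to^* Y g.
Proof. by apply/setP=> x; rewrite !(inE, mem_setactV). Qed.

Lemma setactD X Y g : to^* (X :\: Y) g = to^* X g :\: to^* Y g.
Proof. by apply/setP=> x; rewrite !(inE, mem_setactV). Qed.

Lemma setactU X Y g : to^* (X :|: Y) g = to^* X g :|: to^* Y g.
Proof. by apply/setP=> x; rewrite !(inE, mem_setactV). Qed.

Lemma disjoint_setact X Y g :
  [disjoint to^* X g & to^* Y g] = [disjoint X & Y].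
Proof. by rewrite -!setI_eq0 -setactI -!cards_eq0 card_setact. Qed.

Lemma setact_sub G S X g :
  [acts G, on S | to] -> g \in G -> (to^* X g \subset S) = (X \subset S).
Proof.
move=> actG Gg; apply/subsetP/subsetP=> sXS x.
  by move=> Xx; rewrite -(acts_act actG Gg) sXS // mem_setact.
by rewrite mem_setactV => /sXS; rewrite (acts_act actG) ?groupV.
Qed.

Lemma is_block_setact G X g : g \in G -> is_block G X -> is_block G (to^* X g).
Proof.
move=> Gg /is_blockP blockX; apply/is_blockP => h Gh.
have -> : to^* (to^* X g) h = to^* (to^* X (h ^ g^-1)) g.
  by rewrite -!actM /conjg invgK -!mulgA mulVg mulg1.
rewrite disjoint_setact => ne; apply: blockX; first by rewrite groupJ ?groupV.
by move=> eqX; apply: ne; rewrite eqX.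
Qed.

(* A block through [y] is a union of orbits of the stabiliser of [y], and a
   disjoint translate of it must fit beside it. *)
Lemma no_blocks_stab G S y :
  [transitive G, on S | to] -> y \in S ->
  (forall Y, Y \subset S :\ y -> Y != set0 -> [acts 'C_G[y | to], on Y | to] ->
     #|S| < 2 * #|Y|.+1) ->
  no_blocks G S.
Proof.
move=> trG Sy large X0 sX0S /andP[gt1 ltS].
have actG := atrans_acts trG.
apply/negP=> blockX0.
have [x Xx] : exists x, x \in X0 by apply/card_gt0P; apply: ltnW.
have [g Gg ey] := atransP2 trG (subsetP sX0S x Xx) Sy.
pose X := to^* X0 g; have blockX : is_block G X by apply: is_block_setact.
have cX : #|X| = #|X0| by apply: card_setact.
have sXS : X \subset S by rewrite (setact_sub _ actG).
have Xy : y \in X by rewrite ey mem_setact.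
have big : #|S| < 2 * #|X|.
  have cXy : #|X| = #|X :\ y|.+1 by rewrite (cardsD1 y X) Xy.
  rewrite cXy; apply: large; first exact: setSD.
    by rewrite -cards_eq0 -lt0n -ltnS -cXy cX.
  apply/actsP=> h /setIP[Gh /astab1P fixy] z.
  have -> : (to z h \in X :\ y) = (to z h \in to^* (X :\ y) h).
    rewrite setactD [to^* [set y] h]setactE imset_set1 fixy.
    congr (_ \in _ :\ y); apply/esym/eqP/negPn/negP.
    move=> /eqP/(is_blockP _ _ blockX h Gh)/disjoint_setI0/setP/(_ y).
    by rewrite !inE Xy -{1}fixy mem_setact.
  by rewrite mem_setactE.
have [z /setDP[Sz Xz]] : exists z, z \in S :\: X.
  by apply/card_gt0P; rewrite cardsD (setIidPr sXS) subn_gt0 cX.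
have [h Gh ez] := atransP2 trG Sy Sz.
have dis : [disjoint X & to^* X h].
  apply: (is_blockP _ _ blockX h Gh) => eqX.
  by move/negP: Xz; apply; rewrite ez -eqX mem_setact.
have: #|X :|: to^* X h| <= #|S|.
  by apply: subset_leq_card; rewrite subUset sXS (setact_sub _ actG) ?sXS.
rewrite cardsU (disjoint_setI0 dis) cards0 subn0 card_setact.
by move: big; clear; lia.
Qed.

(* Choose the translate [A'] of [A] with the largest overlap: an element fixing
   [S :\: A] pointwise and moving [A :\: A'] to a set that meets it only partially
   would produce a translate of [A'] with a larger overlap. *)
Lemma jordan_step G S A :
  [acts G, on S | to] -> no_blocks G S -> A \subset S -> 1 < #|A| < #|S| ->
  exists g, [/\ g \in G, to^* A g != A, ~~ [disjoint A & to^* A g],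
    {in G, forall h, to^* A h != A -> #|A :&: to^* A h| <= #|A :&: to^* A g|}
    & is_block 'C_G(S :\: A | to) (A :\: to^* A g)].
Proof.
move=> actG prim sAS cA; have /forall_inPn[g0 Gg0] := prim A sAS cA.
rewrite negb_or => /andP[ne0 meet0].
pose good g := (g \in G) && (to^* A g != A).
have good0 : good g0 by apply/andP.
case: (@arg_maxnP _ g0 good (fun g => #|A :&: to^* A g|) good0).
move=> g /andP[Gg ne] maxg.
have meet : ~~ [disjoint A & to^* A g].
  rewrite -setI_eq0 -card_gt0; apply: leq_trans (maxg g0 good0).
  by rewrite card_gt0 setI_eq0.
exists g; split=> // [h Gh neh | ]; first by apply: maxg; apply/andP.
set A' := to^* A g in ne maxg meet *.
have sA'S : A' \subset S by rewrite (setact_sub _ actG).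
apply/is_blockP => w /setIP[Gw /astabP fixw] neU.
have fixA : to^* A w = A.
  apply/eqP; rewrite eqEcard card_setact leqnn andbT.
  apply/subsetP=> x; rewrite mem_setactV => Ax; apply: contraLR Ax => Ax.
  have [Sx | Sx] := boolP (x \in S).
    have := fixw x; rewrite inE Ax Sx => /(_ isT) ex.
    by rewrite -[x in to x _]ex actK.
  by apply: contra Sx => /(subsetP sAS); rewrite (acts_act actG) ?groupV.
pose U := A :\: A'; pose T := A :&: A'.
have fixD : to^* (A' :\: A) w = A' :\: A.
  rewrite setactE -[RHS](imset_id); apply: eq_in_imset => x /setDP[A'x Ax].
  by apply: fixw; rewrite inE Ax (subsetP sA'S).
have neA' : to^* A' w != A'.
  apply/eqP=> eqA'; apply: neU; rewrite setactD fixA eqA' //.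
(* The overlap of [A] with its translate by [h] has the size of the overlap of [A'] with its
   translate by [w], so the maximality of [g] bounds the latter. *)
pose h := g * w * g^-1.
have Gh : h \in G by rewrite !groupM ?groupV.
have eAh : to^* (to^* A h) g = to^* A' w by rewrite -!actM /h mulgKV actM.
have neh : to^* A h != A.
  by apply: contra neA' => /eqP eqA; rewrite -eAh eqA.
have := maxg h; rewrite /good Gh neh => /(_ isT).
have -> : #|A :&: to^* A h| = #|A' :&: to^* A' w|.
  by rewrite -(card_setact to _ g) setactI eAh.
have cA' : #|A'| = #|A| by apply: card_setact.
have splitA : #|A| = (#|U| + #|T|)%N.
  by rewrite /U /T -(cardsID A' A) addnC.
have cD : #|A' :\: A| = #|U|.
  have := cardsID A A'; rewrite setIC -/T cA' splitA; clear; lia.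
have splitA'w : A' :&: to^* A' w = (A' :\: A) :|: (T :&: to^* T w).
  have eA' : A' = (A' :\: A) :|: T.
    by apply/setP=> x; rewrite !inE; case: (x \in A); case: (x \in A').
  have eA'w : to^* A' w = (A' :\: A) :|: to^* T w.
    by rewrite {1}eA' setactU fixD.
  have sTw : to^* T w \subset A.
    by rewrite setactI fixA subsetIl.
  rewrite {1}eA' eA'w; apply/setP=> x; rewrite !inE.
  by have /implyP := subsetP sTw x;
    case: (x \in A); case: (x \in A'); case: (x \in to^* T w).
have eT : T :&: to^* T w = A :\: (U :|: to^* U w).
  rewrite /T /U setactD setactI fixA; apply/setP=> x; rewrite !inE.
  by case: (x \in A); case: (x \in A'); case: (x \in to^* A' w).
have sUU : U :|: to^* U w \subset A.
  by rewrite subUset subsetDl /U setactD fixA subsetDl.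
have -> : #|A' :&: to^* A' w| = (#|U| + #|T :&: to^* T w|)%N.
  have dD : (A' :\: A) :&: (T :&: to^* T w) = set0.
    by apply/setP=> x; rewrite !inE; case: (x \in A); rewrite ?andbF.
  by rewrite splitA'w cardsU cD dD cards0 subn0.
(* The overlap is [#|U| + #|A| - #|U :|: to^* U w|]; being at most [#|T| = #|A| - #|U|], it forces
   [U] and its translate to be disjoint. *)
rewrite eT cardsD (setIidPr sUU) cardsU card_setact -/T.
have := subset_leq_card (subsetIl U (to^* U w)).
have := subset_leq_card sUU; rewrite cardsU card_setact.
move=> le1 le2 le3; rewrite -/U -setI_eq0 -cards_eq0; apply/eqP.
by move: splitA le1 le2 le3; clear; lia.
Qed.

(** * Jordan sets and their unions *)

Local Notation moving G S A := 'C_G(S :\: A | to).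

Lemma moving_acts G S A :
  [acts G, on S | to] -> A \subset S -> [acts moving G S A, on A | to].
Proof.
move=> actG sAS.
have eA : S :\: (S :\: A) = A by rewrite setDDr setDv set0U (setIidPr sAS).
rewrite -[X in [acts _, on X | _]]eA; apply: actsD.
  exact: subset_trans (subsetIl _ _) actG.
by rewrite subIset // astab_sub orbT.
Qed.

Lemma movingS G S A A' : A \subset A' -> moving G S A \subset moving G S A'.
Proof. by move=> sAA'; rewrite setIS // astabS // setDS. Qed.

Lemma moving_conj G S A g :
  [acts G, on S | to] -> g \in G -> moving G S A :^ g = moving G S (to^* A g).
Proof.
move=> actG Gg; rewrite conjIg conjGid // -astab_setact setactD.
by rewrite (astabs_setact (subsetP actG g Gg)).
Qed.

Lemma trans_moving_setact G S A g :
  [acts G, on S | to] -> g \in G -> [transitive moving G S A, on A | to] ->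
  [transitive moving G S (to^* A g), on to^* A g | to].
Proof.
move=> actG Gg /imsetP[x Ax eA]; apply/imsetP; exists (to x g).
  by rewrite mem_setact.
by rewrite [X in to^* X g = _]eA setact_orbit moving_conj.
Qed.

(** The group of the union contains both groups by [movingS], and a common point of [A] and [A']
    links their orbits. *)
Lemma trans_movingU G S A A' :
  [acts G, on S | to] -> A \subset S -> A' \subset S -> ~~ [disjoint A & A'] ->
  [transitive moving G S A, on A | to] -> [transitive moving G S A', on A' | to] ->
  [transitive moving G S (A :|: A'), on A :|: A' | to].
Proof.
move=> actG sAS sA'S; rewrite -setI_eq0 => /set0Pn[x /setIP[Ax A'x]] trA trA'.
apply/imsetP; exists x; first by rewrite inE Ax.
have sAAS : A :|: A' \subset S by rewrite subUset sAS.
apply/eqP; rewrite eqEsubset; apply/andP; split; last first.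
  by rewrite acts_sub_orbit ?moving_acts // inE Ax.
have sO (C : {set rT}) : C \subset A :|: A' ->
    orbit to (moving G S C) x \subset orbit to (moving G S (A :|: A')) x.
  by move=> sC; rewrite imsetS ?movingS.
have := sO A (subsetUl _ _); have := sO A' (subsetUr _ _).
by rewrite (atransP trA x Ax) (atransP trA' x A'x) subUset => -> ->.
Qed.

(** The block [A :\: to^* A g] from [jordan_step] is nonempty and proper, so by primitivity it is a
    single point. *)
Lemma moving_grow G S A :
  [acts G, on S | to] -> no_blocks G S -> A \subset S -> 1 < #|A| < #|S| ->
  [transitive moving G S A, on A | to] -> no_blocks (moving G S A) A ->
  exists g, let A' := A :|: to^* A g in
    [/\ g \in G, to^* A g \subset S, #|A'| = #|A|.+1
      & [transitive moving G S A', on A' | to]].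
Proof.
move=> actG prim sAS cA trA primA.
have [g [Gg ne meet _ blockU]] := jordan_step actG prim sAS cA.
have sA'S : to^* A g \subset S by rewrite (setact_sub _ actG).
exists g; split=> //; last by apply: trans_movingU; rewrite ?trans_moving_setact.
have U0 : 0 < #|A :\: to^* A g|.
  rewrite card_gt0 setD_eq0; apply: contra ne => sAA'.
  by rewrite eq_sym eqEcard sAA' card_setact /=.
have T0 : 0 < #|A :&: to^* A g| by rewrite card_gt0 setI_eq0.
have small : ~~ (1 < #|A :\: to^* A g| < #|A|).
  by apply/negP=> /(primA _ (subsetDl _ _)); rewrite blockU.
have cT := cardsID (to^* A g) A; rewrite cardsU card_setact.
have ltA := subset_leq_card (subsetIl A (to^* A g)).
by move: U0 T0 small cT ltA; clear; lia.
Qed.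

(** * Elements of prime order with one or two cycles *)

Lemma card_orbit_prime z x :
  prime #[z] -> to x z != x -> #|orbit to <[z]> x| = #[z].
Proof.
move=> /primeP[_ prz] nfix; have := prz _ (dvdn_orbit to <[z]> x).
case/orP=> /eqP // /card_orbit1 eqO; have := mem_orbit to x (cycle_id z).
by rewrite eqO inE (negPf nfix).
Qed.

Lemma prime_dvd_moved z Y :
  prime #[z] -> [acts <[z]>, on Y | to] -> {in Y, forall x, to x z != x} ->
  #[z] %| #|Y|.
Proof.
move=> pr_z actY mv.
have pgz : #[z].-group <[z]> by rewrite /pgroup -orderE pnat_id.
have fix0 : 'Fix_(Y | to)(<[z]>) = set0.
  apply/setP=> x; rewrite afix_cycle !inE; apply/andP=> -[Yx].
  by rewrite sub1set inE (negPf (mv x Yx)).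
by have := pgroup_fix_mod pgz actY; rewrite fix0 cards0 mod0n /dvdn => ->.
Qed.

Lemma prime_dvd_moved_compl z S :
  prime #[z] -> [acts <[z]>, on S | to] -> #[z] %| #|S :\: 'Fix_to[z]|.
Proof.
move=> pr_z actS; apply: (prime_dvd_moved) => // [|x].
  apply: actsD => //; rewrite cycle_subG; apply/astabsP => x.
  by apply/afix1P/afix1P => [/act_inj | e]; rewrite ?e.
by case/setDP=> _; rewrite !inE sub1set inE.
Qed.

Lemma small_fixed z S x :
  prime #[z] -> [acts <[z]>, on S | to] -> #|S| < #[z] -> x \in S -> to x z = x.
Proof.
move=> pr_z actS ltS Sx; apply/eqP; apply: contraLR ltS => nfix.
rewrite -leqNgt -(card_orbit_prime pr_z nfix) subset_leq_card //.
by rewrite acts_sub_orbit.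
Qed.

(** If two points of [U] lie in one orbit, the power of [z] taking one to the other stabilises [U].
    This power generates [<[z]>], so [U] would contain the whole orbit of [#[z]] points. *)
Lemma block_meets_orbit (G : {group aT}) U z x :
  is_block G U -> z \in G -> prime #[z] -> #|U| < #[z] -> to x z != x ->
  #|U :&: orbit to <[z]> x| <= 1.
Proof.
move=> /is_blockP blockU Gz pr_z ltU nfix; rewrite leqNgt; apply/negP.
case/card_gt1P=> a [b [/setIP[Ua Oa] /setIP[Ub Ob] neab]].
have [_ /cycleP[i ->] eb] : exists2 w, w \in <[z]> & to a w = b.
  by apply/orbitP; rewrite (orbit_eqP Oa).
have Gzi : z ^+ i \in G by rewrite groupX.
have fixU : to^* U (z ^+ i) = U.
  apply/eqP/negPn/negP=> /eqP/(blockU _ Gzi)/disjoint_setI0/setP/(_ b).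
  by rewrite !inE Ub -eb mem_setact.
have cop : coprime #[z] i.
  rewrite prime_coprime // order_dvdn; apply: contra neab => /eqP zi1.
  by rewrite -eb zi1 act1.
have gen : <[z]> \subset 'N(U | to).
  rewrite cycle_subG.
  have /cycleP[j ->] : z \in <[z ^+ i]>.
    have /eqP <- : generator <[z]> (z ^+ i) by rewrite generator_coprime.
    exact: cycle_id.
  have Nzi : z ^+ i \in 'N(U | to) by rewrite -astab1_set; apply/astab1P.
  exact: groupX.
have : orbit to <[z]> a \subset U by rewrite acts_sub_orbit.
move/subset_leq_card; rewrite (orbit_eqP Oa) card_orbit_prime //.
by rewrite leqNgt ltU.
Qed.

(** The moved points form one cycle [A], which has no blocks because its size is prime. [A] grows to
    a transitive set [Y] with one more point; [Y] is again primitive, since [z] fixes the new point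
    and is transitive on the others, and so it grows once more. *)
Lemma jordan_cycle G S z :
  [acts G, on S | to] -> no_blocks G S -> z \in G -> prime #[z] ->
  #|S :\: 'Fix_to[z]| = #[z] -> #[z].+1 < #|S| ->
  (#[z].+1 %| #|G|) && (#[z].+2 %| #|G|).
Proof.
move=> actG prim Gz pr_z cA ltS; set A := S :\: _ in cA.
have p_gt1 := prime_gt1 pr_z.
have sAS : A \subset S by apply: subsetDl.
have mvA : {in A, forall x, to x z != x}.
  by move=> x /setDP[_]; rewrite !inE sub1set inE.
have movz (B : {set rT}) : A \subset B -> z \in moving G S B.
  move=> sAB; rewrite inE Gz; apply/astabP=> x /setDP[Sx Bx].
  apply/eqP; apply: contraR Bx => nfix; apply: (subsetP sAB).
  by rewrite !inE sub1set inE nfix.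
have orbA x : x \in A -> orbit to <[z]> x = A.
  move=> Ax; apply/eqP; rewrite eqEcard card_orbit_prime ?mvA // cA leqnn andbT.
  rewrite acts_sub_orbit //; apply: subset_trans (moving_acts actG sAS).
  by rewrite cycle_subG movz.
have trA : [transitive moving G S A, on A | to].
  have [x Ax] : exists x, x \in A by apply/card_gt0P; rewrite cA prime_gt0.
  apply/imsetP; exists x => //; apply/eqP; rewrite eqEsubset andbC.
  rewrite acts_sub_orbit ?moving_acts // Ax.
  have : orbit to <[z]> x \subset orbit to (moving G S A) x.
    by rewrite imsetS // cycle_subG movz.
  by rewrite (orbA x Ax).
have primA : no_blocks (moving G S A) A.
  move=> X sXA /andP[X1 ltX]; apply/negP=> blockX.
  have [x Xx] : exists x, x \in X by apply/card_gt0P; apply: ltnW.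
  have Ax := subsetP sXA x Xx.
  have := block_meets_orbit blockX (movz A (subxx _)) pr_z _ (mvA x Ax).
  by rewrite -cA orbA // (setIidPl sXA) => /(_ ltX); rewrite leqNgt X1.
have cAS : 1 < #|A| < #|S| by rewrite cA p_gt1 ltnW.
have [g [Gg sA'S cY trY]] := moving_grow actG prim sAS cAS trA primA.
set Y := A :|: _ in cY trY; have sYS : Y \subset S by rewrite subUset sAS.
have sAY : A \subset Y by apply: subsetUl.
have [y /setDP[Yy Ay]] : exists y, y \in Y :\: A.
  by apply/card_gt0P; rewrite cardsD (setIidPr sAY) cY subSnn.
have YyA : Y :\ y = A.
  apply/esym/eqP; rewrite eqEcard subsetD1 sAY Ay /=.
  by have := cardsD1 y Y; rewrite cY Yy add1n => -[->].
have primY : no_blocks (moving G S Y) Y.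
  apply: (no_blocks_stab trY Yy) => X; rewrite YyA => sXA /set0Pn[x Xx] actX.
  suff -> : X = A by rewrite cY; clear; lia.
  apply/eqP; rewrite eqEsubset sXA -(orbA x (subsetP sXA x Xx)).
  rewrite acts_sub_orbit //; apply: subset_trans actX.
  rewrite cycle_subG inE movz //=; apply/astab1P; apply/eqP.
  by apply: contraR Ay => nfix; rewrite !inE sub1set inE nfix (subsetP sYS).
have cYS : 1 < #|Y| < #|S| by rewrite cY cA ltnS prime_gt0.
have [h [Gh sY'S cY' /atrans_dvd]] := moving_grow actG prim sYS cYS trY primY.
rewrite cY' cY cA => dvd2; have := atrans_dvd trY; rewrite cY cA => dvd1.
by rewrite (dvdn_trans dvd1) ?(dvdn_trans dvd2) // cardSg ?subsetIl.
Qed.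

(** With [p = #[z]], the union [Y] of [A] and a translate of largest overlap has [2 * p + 1] or
    [2 * p + 2] points. The orbit [R] of a new point has [p + 1] or [2 * p + 2] points, or else
    [R = Y] is primitive of size [2 * p + 1] and grows by one point. *)
Lemma jordan_two_cycles G S z :
  [acts G, on S | to] -> no_blocks G S -> z \in G -> prime #[z] -> 2 < #[z] ->
  #|S :\: 'Fix_to[z]| = (2 * #[z])%N -> #|S| = (3 * #[z])%N ->
  #[z].+1 %| #|G|.
Proof.
move=> actG prim Gz pr_z z_gt2 cA cS; set A := S :\: _ in cA.
have sAS : A \subset S by apply: subsetDl.
have mvA : {in A, forall x, to x z != x}.
  by move=> x /setDP[_]; rewrite !inE sub1set inE.
have fixA x : x \in S -> x \notin A -> to x z = x.
  move=> Sx Ax; apply/eqP; apply: contraR Ax => nfix.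
  by rewrite !inE sub1set inE nfix.
have movz (B : {set rT}) : A \subset B -> z \in moving G S B.
  move=> sAB; rewrite inE Gz; apply/astabP=> x /setDP[Sx Bx].
  by apply: fixA => //; apply: contra Bx; apply: subsetP.
clearbody A; have cAS : 1 < #|A| < #|S| by rewrite cA cS; move: z_gt2; clear; lia.
have [g [Gg neA meet maxg blockU]] := jordan_step actG prim sAS cAS.
set A' := to^* A g in neA meet maxg blockU.
have cA' : #|A'| = (2 * #[z])%N by rewrite card_setact.
have sA'S : A' \subset S by rewrite (setact_sub _ actG).
set U := A :\: A' in blockU; set W := A' :\: A.
have cU : (#|A :&: A'| + #|U| = 2 * #[z])%N by rewrite cardsID.
have cW : (#|A :&: A'| + #|W| = 2 * #[z])%N by rewrite setIC cardsID.
(* As [S :\: A] is no block, [A] and some other translate of it do not cover [S]. Their overlap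
   exceeds [#[z]], hence so does the largest one. *)
have ltU : #|U| < #[z].
  have cX : #|S :\: A| = #[z] by rewrite cardsD (setIidPr sAS) cA cS; clear; lia.
  have : ~~ is_block G (S :\: A).
    by apply: prim; rewrite ?subsetDl // cX cS; move: z_gt2; clear; lia.
  case/forall_inPn=> h Gh; rewrite negb_or => /andP[neX meetX].
  have sAhS : to^* A h \subset S by rewrite (setact_sub _ actG).
  have eX : to^* (S :\: A) h = S :\: to^* A h.
    by rewrite setactD (astabs_setact (subsetP actG h Gh)).
  have neAh : to^* A h != A by apply: contra neX => /eqP eA; rewrite eX eA.
  have ltAA : #|A :|: to^* A h| < #|S|.
    apply: proper_card; rewrite properE subUset sAS sAhS /=.
    apply: contra meetX => sS; rewrite -setI_eq0 eX -setDUr.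
    by rewrite setD_eq0.
  have := cardsUI A (to^* A h); have := maxg h Gh neAh.
  by rewrite card_setact; move: ltAA cU; rewrite cA cS; clear; lia.
have cUW : #|U| = #|W| by move: cU cW; clear; lia.
have U0 : 0 < #|U|.
  rewrite card_gt0 setD_eq0; apply: contra neA => sAA'.
  by rewrite eq_sym eqEcard sAA' cA cA' leqnn.
have UorbA x : x \in A -> #|U :&: orbit to <[z]> x| <= 1.
  by move=> Ax; apply: (block_meets_orbit blockU (movz A _)); rewrite ?mvA.
have orbA x : x \in A -> orbit to <[z]> x \subset A.
  move=> Ax; rewrite acts_sub_orbit //.
  by apply: subset_trans (moving_acts actG sAS); rewrite cycle_subG movz.
have stabA (R : {set rT}) : z \in 'N(R | to) -> [acts <[z]>, on R :&: A | to].
  move=> zR; apply: subset_trans (astabsI _ _ _).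
  rewrite cycle_subG inE zR /=; apply: (subsetP (moving_acts actG sAS)).
  exact: movz.
have dvdA (R : {set rT}) : z \in 'N(R | to) -> #[z] %| #|R :&: A|.
  move=> /stabA/prime_dvd_moved; apply=> // x /setIP[_]; exact: mvA.
(* [A] is the union of two orbits of [z], each meeting the block [U] in at most
   one point. *)
have halfU (R : {set rT}) :
    z \in 'N(R | to) -> #|R :&: A| = #[z] -> #|R :&: U| <= 1.
  move=> zR cR; have [x RAx] : exists x, x \in R :&: A.
    by apply/card_gt0P; rewrite cR ltnW // ltnW.
  have Ax : x \in A by case/setIP: RAx.
  have eO : orbit to <[z]> x = R :&: A.
    apply/eqP; rewrite eqEcard acts_sub_orbit ?stabA // RAx.
    by rewrite card_orbit_prime ?mvA // cR leqnn.
  apply: leq_trans (UorbA x Ax); rewrite eO; apply: subset_leq_card.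
  by apply/subsetP=> y /setIP[Ry Uy]; rewrite in_setI Uy in_setI Ry; case/setDP: Uy.
have leU2 : #|U| <= 2.
  have [x Ax] : exists x, x \in A by apply/card_gt0P; rewrite cA muln_gt0 order_gt0.
  have cO := card_orbit_prime pr_z (mvA x Ax).
  have [y /setDP[Ay Oy]] : exists y, y \in A :\: orbit to <[z]> x.
    apply/card_gt0P; rewrite cardsD (setIidPr (orbA x Ax)) cA cO mul2n.
    by rewrite -addnn addnK order_gt0.
  have dO : [disjoint orbit to <[z]> x & orbit to <[z]> y].
    rewrite -setI_eq0; apply: contraR Oy => /set0Pn[w /setIP[Ox]].
    by rewrite orbit_sym => /orbit_trans; apply.
  have eA : A = orbit to <[z]> x :|: orbit to <[z]> y.
    apply/esym/eqP; rewrite eqEcard subUset !orbA // cardsU (disjoint_setI0 dO).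
    by rewrite cards0 cO (card_orbit_prime pr_z (mvA y Ay)) cA mul2n addnn subn0 leqnn.
  have -> : U = U :&: A by rewrite (setIidPl (subsetDl _ _)).
  rewrite eA setIUr; apply: leq_trans (leq_card_setU _ _) _.
  by have := leq_add (UorbA x Ax) (UorbA y Ay).
set Y := A :|: A'; have sYS : Y \subset S by rewrite subUset sAS.
have cY : #|Y| = (2 * #[z] + #|U|)%N.
  by have := cardsUI A A'; rewrite cA cA' -/Y; move: cU; clear; lia.
have actY := moving_acts actG sYS.
pose z' := z ^ g; have oz' : #[z'] = #[z] by rewrite orderJ.
have mov'z : z' \in moving G S Y.
  apply: subsetP (movingS G S (subsetUr A A')) _ _.
  by rewrite -moving_conj // memJ_conjg movz.
have mvA' : {in A', forall x, to x z' != x}.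
  move=> x; rewrite mem_setactV => /mvA; apply: contra => /eqP fixx.
  by apply/eqP/(act_inj to g); rewrite actCJ actKV.
have [y /setDP[A'y Ay]] : exists y, y \in W by apply/card_gt0P; rewrite -cUW.
have Yy : y \in Y by rewrite inE A'y orbT.
pose R := orbit to (moving G S Y) y; have Ry : y \in R by apply: orbit_refl.
have sRY : R \subset Y by rewrite acts_sub_orbit.
have actR : [acts moving G S Y, on R | to] by exact: atrans_acts (atrans_orbit _ _ _).
have movzY := movz Y (subsetUl _ _).
have zR : z \in 'N(R | to) by apply: subsetP actR _ movzY.
have dvdRG : #|R| %| #|G|.
  by apply: dvdn_trans (dvdn_orbit _ _ _) _; rewrite cardSg ?subsetIl.
have dvdRA' : #[z] %| #|R :&: A'|.
  rewrite -oz'; apply: (@prime_dvd_moved z'); first by rewrite oz'.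
    apply: subset_trans (astabsI _ _ _); rewrite cycle_subG inE.
    rewrite (subsetP actR) //=; apply: (subsetP (moving_acts actG sA'S)).
    by rewrite -moving_conj // memJ_conjg movz.
  by move=> x /setIP[_]; apply: mvA'.
have RA'0 : 0 < #|R :&: A'| by apply/card_gt0P; exists y; rewrite inE Ry.
have leRW : #|R :\: A| <= #|W|.
  apply: subset_leq_card; rewrite subDset; apply: subset_trans sRY _.
  by rewrite /W setDE setUIr setUCr setIT.
have RA0 : 0 < #|R :\: A| by apply/card_gt0P; exists y; rewrite inE Ay.
have eRA := cardsID A R; have eRA' := cardsID A' R.
have eRU : #|R :\: A'| = #|R :&: U|.
  congr #|pred_of_set _|; apply/setP=> x; rewrite !inE.
  have /implyP := subsetP sRY x; rewrite inE.
  by case: (x \in R); case: (x \in A); case: (x \in A').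
have := dvdA R zR; case/dvdnP: dvdRA' => i' eRi' /dvdnP[i eRi].
have i'_gt0 : 0 < i' by case: (i') eRi' RA'0 => // ->.
have i_le2 : i <= 2.
  have := subset_leq_card (subsetIr R A); rewrite eRi cA.
  by rewrite leq_pmul2r // ltnW // ltnW.
have i'_le2 : i' <= 2.
  have := subset_leq_card (subsetIr R A'); rewrite eRi' cA'.
  by rewrite leq_pmul2r // ltnW // ltnW.
have RU_le : #|R :&: U| <= #|U| by apply/subset_leq_card/subsetIr.
(* [i] is the number of cycles of [z] in [A] that lie in [R]. *)
have [i1 | i2 | ] : [\/ i = 1, i = 2 | i = 0]%N.
- by move: i_le2; case: (i) => [|[|[|]]] // _; [apply: Or33|apply: Or31|apply: Or32].
- have RU1 : #|R :&: U| <= 1 by apply: halfU; rewrite // eRi i1 mul1n.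
  suff <- : #|R| = #[z].+1 by [].
  move: eRA eRA'; rewrite eRi eRi' eRU i1 mul1n.
  move: z_gt2 i'_gt0 i'_le2 RU1 leRW RA0 leU2; rewrite -cUW.
  by clear; case: (i') => [|[|[|]]] // *; lia.
- have sAR : A \subset R.
    by apply/setIidPr/eqP; rewrite eqEcard subsetIr cA eRi i2 leqnn.
  have eRUU : #|R :&: U| = #|U|.
    by rewrite (setIidPr _) //; apply: subset_trans sAR; apply: subsetDl.
  have [R2 | R1] : #|R :\: A| = 2 \/ #|R :\: A| = 1%N.
  + by move: RA0 leRW leU2; rewrite -cUW; clear; lia.
  + apply: dvdn_trans dvdRG; rewrite -eRA eRi i2 R2.
    by apply/dvdnP; exists 2; clear; lia.
  have U1 : #|U| = 1%N.
    move: eRA eRA' z_gt2 i'_gt0 i'_le2 leU2.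
    rewrite eRi eRi' eRU eRUU i2 R1; clear; case: (i') => [|[|[|]]] // *; lia.
  have eRY : R = Y.
    by apply/eqP; rewrite eqEcard sRY cY -eRA eRi i2 R1 U1 leqnn.
  have trY : [transitive moving G S Y, on Y | to].
    by apply/imsetP; exists y.
  have primY : no_blocks (moving G S Y) Y.
    (* Here [y] is the only point of [Y] outside [A], so a stable set of other points consists of
       whole cycles of [z]. *)
    apply: (no_blocks_stab trY Yy) => X sXY /set0Pn[x Xx] actX.
    have sXA : X \subset A.
      apply/subsetP=> w Xw; have /setD1P[ne Yw] := subsetP sXY w Xw.
      apply: contraR ne => Aw; have cWle : #|W| <= 1 by rewrite -cUW U1.
      move: Yw; rewrite inE (negPf Aw) /= => A'w; apply/eqP.
      by apply: (card_le1_eqP cWle); rewrite inE ?Aw ?A'w ?Ay.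
    have := @prime_dvd_moved z X pr_z.
    have -> : [acts <[z]>, on X | to].
      apply: subset_trans actX; rewrite cycle_subG inE movzY /=.
      by apply/astab1P/fixA; rewrite ?(subsetP sYS).
    move/(_ isT (fun w Xw => mvA w (subsetP sXA w Xw))) => /dvdn_leq leX.
    have := leX _; rewrite card_gt0; case: set0Pn => [_ | []]; last by exists x.
    by move=> /(_ isT); rewrite cY U1; clear; lia.
  have cYS : 1 < #|Y| < #|S| by rewrite cY cS U1; move: z_gt2; clear; lia.
  have [h [Gh _ cY' /atrans_dvd]] := moving_grow actG prim sYS cYS trY primY.
  rewrite cY' cY U1 => dvd; apply: dvdn_trans (dvdn_trans dvd _).
    by apply/dvdnP; exists 2; clear; lia.
  by rewrite cardSg ?subsetIl.
(* Now [R] lies outside [A], so it has at most two points, yet it contains at least [#[z]] points of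
   [A']. *)
move=> i0; move: eRA eRA'; rewrite eRi eRi' eRU i0 mul0n add0n => e1 e2.
move: leRW leU2 z_gt2 i'_gt0; rewrite -cUW; move: e1 e2; clear.
by case: (i') => // m; lia.
Qed.

End Blocks.

(** * Fixed points and kernels in imprimitive designs *)

Lemma double_count (X Y : finType) (A : {set X}) (C : {set Y})
    (R : X -> Y -> bool) m n :
  {in A, forall x, #|[set y in C | R x y]| = m} ->
  {in C, forall y, #|[set x in A | R x y]| = n} ->
  (#|A| * m = #|C| * n)%N.
Proof.
move=> Am Cn.
transitivity (\sum_(x in A) \sum_(y in C) R x y)%N.
  rewrite -sum_nat_const; apply: eq_bigr => x /Am <-.
  rewrite -sum1_card big_mkcond [RHS]big_mkcond; apply: eq_bigr => y _.
  by rewrite inE; case: (y \in C).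
rewrite exchange_big -sum_nat_const; apply: eq_bigr => y /Cn <-.
rewrite -sum1_card big_mkcond [RHS]big_mkcond; apply: eq_bigr => x _.
by rewrite inE; case: (x \in A).
Qed.

Lemma uniform_fibers (X Y : finType) (A : {set X}) (f : X -> Y) m :
  {in A, forall x, #|[set y in A | f y == f x]| = m} -> m %| #|A|.
Proof.
move=> Am; apply/dvdnP; exists #|f @: A|; rewrite -[LHS]muln1.
apply: (double_count (R := fun x y => f x == y)) => [x Ax | y /imsetP[x Ax ->]].
  rewrite -(cards1 (f x)); apply: eq_card => y; rewrite !inE andbC eq_sym.
  by rewrite andb_idr // => /eqP->; apply: imset_f.
exact: Am.
Qed.

(** * Counting with points, blocks and classes *)

Section Configuration.

Local Open Scope group_scope.

Variables (T : finType) (B Q : {set {set T}}) (G : {group {perm T}}).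
Variables (k lam r c d l : nat).

Local Notation "A ^^ g" := ('P^*%act A g) (at level 30).

Hypotheses (card_block : forall b, b \in B -> #|b| = k)
  (deg2 : forall x y, x != y -> #|[set b in B | (x \in b) && (y \in b)]| = lam)
  (deg1 : forall x, #|[set b in B | x \in b]| = r)
  (actB : [acts G, on B | 'P^*]) (ftG : flag_transitive B G)
  (partQ : partition Q [set: T]) (actQ : [acts G, on Q | 'P^*])
  (card_class : forall D, D \in Q -> #|D| = c) (card_Q : #|Q| = d)
  (card_meet : forall b D x, b \in B -> D \in Q -> x \in b -> x \in D ->
     #|b :&: D| = l)
  (lam_gt0 : 0 < lam) (r_gt0 : 0 < r) (l_gt1 : 1 < l) (lt_lc : l < c)
  (d_gt1 : 1 < d).

Local Notation cls := (pblock Q).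

Let covQ x : x \in cover Q.
Proof. by case/and3P: partQ => /eqP->; rewrite inE. Qed.

Let trivQ : trivIset Q.
Proof. by case/and3P: partQ. Qed.

Let cls_in x : cls x \in Q.
Proof. exact: pblock_mem. Qed.

Let mem_cls x : x \in cls x.
Proof. by rewrite mem_pblock. Qed.

Let clsE D x : D \in Q -> x \in D -> cls x = D.
Proof. exact: def_pblock. Qed.

Lemma flag_trans x b x' b' :
  b \in B -> x \in b -> b' \in B -> x' \in b' ->
  exists2 g, g \in G & 'P%act x g = x' /\ b ^^ g = b'.
Proof.
move=> Bb bx Bb' b'x'.
have fl : (x, b) \in flags B by rewrite inE /= Bb.
have fl' : (x', b') \in flags B by rewrite inE /= Bb'.
have [g Gg [-> ->]] := atransP2 ftG fl fl'.
by exists g.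
Qed.

Lemma block_at x : exists2 b, b \in B & x \in b.
Proof.
have /card_gt0P[b] : 0 < #|[set b in B | x \in b]| by rewrite deg1.
by rewrite inE => /andP[]; exists b.
Qed.

Lemma block_nonempty b : b \in B -> 0 < #|b|.
Proof.
have /card_gt0P[f _] : 0 < #|flags B|.
  by rewrite card_gt0; apply/set0Pn; have /imsetP[f] := ftG; exists f.
have [b0 Bb0 b0x] := block_at f.1; move=> Bb.
by rewrite (card_block Bb) -(card_block Bb0); apply/card_gt0P; exists f.1.
Qed.

Lemma block_at2 x y : exists b, [/\ b \in B, x \in b & y \in b].
Proof.
have [<- | ne] := eqVneq x y; first by have [b] := block_at x; exists b.
have /card_gt0P[b] : 0 < #|[set b in B | (x \in b) && (y \in b)]| by rewrite deg2.
by rewrite inE => /and3P[]; exists b.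
Qed.

Lemma blockJ g b : g \in G -> (b ^^ g \in B) = (b \in B).
Proof. by move=> Gg; rewrite (acts_act actB). Qed.

Lemma classJ g D : g \in G -> (D ^^ g \in Q) = (D \in Q).
Proof. by move=> Gg; rewrite (acts_act actQ). Qed.

Lemma clsJ g x : g \in G -> cls ('P%act x g) = cls x ^^ g.
Proof. by move=> Gg; apply: clsE; rewrite ?classJ // mem_setactE. Qed.

Lemma stab_cls x g : g \in 'C_G[x | 'P] -> cls x ^^ g = cls x.
Proof. by case/setIP=> Gg /astab1P fx; rewrite -clsJ ?fx. Qed.

(* Flag-transitivity makes the stabiliser of [x] transitive on the [r] blocks
   through [x], which all meet a stable set [Y] in equally many points. *)
Lemma stable_dvd x (Y : {set T}) :
  x \notin Y -> [acts 'C_G[x | 'P], on Y | 'P] -> r %| lam * #|Y|.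
Proof.
move=> Yx actY; have [b0 Bb0 b0x] := block_at x.
apply/dvdnP; exists #|[set y in Y | y \in b0]|.
rewrite mulnC [RHS]mulnC -(deg1 x).
apply: (double_count (R := fun y (b : {set T}) => y \in b)) => [y Yy | b].
  rewrite -(@deg2 x y); last by apply: contraNneq Yx => ->.
  by apply: eq_card => b; rewrite !inE andbA.
rewrite inE => /andP[Bb bx].
have [g Gg [fx <-]] := flag_trans Bb0 b0x Bb bx.
rewrite -[RHS](card_setact 'P _ g); apply: eq_card => y.
have Cg : g \in 'C_G[x | 'P] by rewrite inE Gg; apply/astab1P.
rewrite [RHS]mem_setactV !inE (mem_setactV _ b0); congr (_ && _).
by rewrite (acts_act actY) // groupV.
Qed.

Lemma setact_setI (A C : {set T}) g : (A :&: C) ^^ g = A ^^ g :&: C ^^ g.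
Proof. exact: setactI. Qed.

Lemma setact_norm (D : {set T}) g : D ^^ g = D -> g \in 'N(D | 'P).
Proof. by move=> fD; rewrite -astab1_set; apply/astab1P. Qed.

Lemma card_cover_classes (Y : {set {set T}}) :
  Y \subset Q -> #|cover Y| = (#|Y| * c)%N.
Proof.
move=> sYQ; rewrite -[LHS]muln1.
apply: (double_count (R := fun x (D : {set T}) => x \in D)) => [x|D YD].
  case/bigcupP=> D YD Dx; rewrite -(cards1 D); apply: eq_card => E.
  rewrite !inE; apply/andP/eqP => [[YE Ex] | -> //].
  by rewrite -(clsE (subsetP sYQ E YE) Ex) (clsE (subsetP sYQ D YD) Dx).
rewrite -(card_class (subsetP sYQ D YD)); apply: eq_card => x.
by rewrite !inE andb_idl // => Dx; apply/bigcupP; exists D.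
Qed.

Lemma card_points : #|T| = (c * d)%N.
Proof.
rewrite mulnC -card_Q -card_cover_classes ?subxx //; apply: eq_card => x.
by rewrite covQ.
Qed.

Lemma card_blocks_class x D :
  D \in Q -> x \notin D ->
  (#|[set b in B | (x \in b) && ~~ [disjoint b & D]]| * l = lam * c)%N.
Proof.
move=> QD Dx; rewrite -(card_class QD) mulnC [RHS]mulnC mulnC.
apply/esym.
apply: (double_count (R := fun y (b : {set T}) => y \in b)) => [y Dy | b].
  rewrite -(@deg2 x y); last by apply: contraNneq Dx => ->.
  apply: eq_card => b; rewrite !inE -!andbA; congr [&& _, _ & _].
  by rewrite andb_idl // => yb; apply/pred0Pn; exists y; rewrite /= yb.
rewrite inE => /and3P[Bb bx /pred0Pn[y /andP[/= by_ Dy]]].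
by rewrite -(card_meet Bb QD by_ Dy); apply: eq_card => z; rewrite !inE andbC.
Qed.

Lemma card_classes_block b :
  b \in B -> (#|[set D in Q | ~~ [disjoint b & D]]| * l = k)%N.
Proof.
move=> Bb; rewrite -(card_block Bb) -[RHS]muln1.
apply/esym/(double_count (R := fun y (D : {set T}) => y \in D)) => [y yb | D].
  rewrite -(cards1 (cls y)); apply: eq_card => D.
  rewrite !inE; apply/andP/eqP => [[/andP[QD _] Dy] | ->].
    by rewrite (clsE QD Dy).
  by rewrite cls_in mem_cls; split=> //; apply/pred0Pn; exists y; rewrite /= yb mem_cls.
rewrite inE => /andP[QD /pred0Pn[y /andP[/= by_ Dy]]].
by rewrite -(card_meet Bb QD by_ Dy); apply: eq_card => z; rewrite !inE.
Qed.

Lemma trans_points : [transitive G, on [set: T] | 'P].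
Proof.
have /imsetP[[x b] _ _] := ftG; apply/imsetP; exists x => //.
apply/esym/setP=> y; rewrite [RHS]inE; apply/orbitP.
have [b1 Bb1 b1x] := block_at x; have [b2 Bb2 b2y] := block_at y.
by have [g Gg [ey _]] := flag_trans Bb1 b1x Bb2 b2y; exists g.
Qed.

Lemma class_nonempty D : D \in Q -> exists x, x \in D.
Proof. by move=> QD; apply/card_gt0P; rewrite card_class // (leq_trans _ lt_lc). Qed.

Lemma trans_classes : [transitive G, on Q | 'P^*].
Proof.
have /card_gt0P[D QD] : 0 < #|Q| by rewrite card_Q ltnW.
apply/imsetP; exists D => //; apply/eqP; rewrite eqEsubset acts_sub_orbit // QD.
rewrite andbT; apply/subsetP=> E QE.
have [x Dx] := class_nonempty QD.
have [y Ey] := class_nonempty QE.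
have [g Gg ey] := atransP2 trans_points (in_setT x) (in_setT y).
apply/orbitP; exists g => //.
by rewrite -(clsE QD Dx) -clsJ // -[X in cls X]ey (clsE QE Ey).
Qed.

Lemma trans_in_class D : D \in Q -> [transitive 'N_G(D | 'P), on D | 'P].
Proof.
move=> QD; have [x Dx] := class_nonempty QD; apply/imsetP; exists x => //.
apply/eqP; rewrite eqEsubset acts_sub_orbit ?subsetIr // Dx andbT.
apply/subsetP=> y Dy.
have [g Gg ey] := atransP2 trans_points (in_setT x) (in_setT y).
apply/orbitP; exists g => //; apply/setIP; split=> //; apply: setact_norm.
by rewrite -[in LHS](clsE QD Dx) -clsJ // -ey (clsE QD Dy).
Qed.

(** The stabiliser of a point of [D] preserves [D], so [stable_dvd] applies to its invariant sets;
    by [numc] a nontrivial block would fill more than half of [D]. *)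
Lemma no_blocks_class D :
  (forall n, 0 < n -> r %| lam * n -> c < 2 * n.+1) ->
  D \in Q -> no_blocks 'P 'N_G(D | 'P) D.
Proof.
move=> numc QD; have [x Dx] := class_nonempty QD.
apply: (no_blocks_stab (trans_in_class QD) Dx) => Y sY Y0 actY.
rewrite card_class //; apply: numc; first by rewrite card_gt0.
apply: (@stable_dvd x); first by apply/negP => /(subsetP sY); rewrite !inE eqxx.
apply: subset_trans actY; apply/subsetP => g Cg.
case/setIP: (Cg) => Gg Cx; apply/setIP; split=> //; apply/setIP; split=> //.
by apply: setact_norm; rewrite -(clsE QD Dx) stab_cls.
Qed.

(** A set of [n] classes that is invariant under the stabiliser of a point covers [n * c] points, to
    which [stable_dvd] applies. *)
Lemma no_blocks_classes :
  (forall n, 0 < n -> r %| lam * (n * c) -> d < 2 * n.+1) ->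
  no_blocks 'P^* G Q.
Proof.
move=> numd; have /card_gt0P[D QD] : 0 < #|Q| by rewrite card_Q ltnW.
have [x Dx] := class_nonempty QD.
apply: (no_blocks_stab trans_classes QD) => Y sY Y0 actY.
have sYQ : Y \subset Q by apply: subset_trans sY (subsetDl _ _).
rewrite card_Q; apply: numd; first by rewrite card_gt0.
rewrite -card_cover_classes //; apply: (@stable_dvd x).
  apply/bigcupP=> -[E YE Ex]; have := subsetP sY E YE.
  by rewrite !inE -(clsE QD Dx) (clsE (subsetP sYQ E YE) Ex) eqxx.
apply/actsP=> g Cg y.
have CgD : g \in 'C_G[D | 'P^*].
  case/setIP: (Cg) => Gg _; rewrite inE Gg; apply/astab1P.
  by rewrite -(clsE QD Dx) stab_cls.
have cYE z : (z \in cover Y) = (cls z \in Y).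
  apply/bigcupP/idP => [[E YE Ez] | Yz]; last by exists (cls z).
  by rewrite (clsE (subsetP sYQ E YE) Ez).
case/setIP: (Cg) => Gg _.
by rewrite !cYE clsJ // (acts_act actY).
Qed.

(** * Fixed points and blocks of an element of prime order *)

Section Fixed.

Variable g : {perm T}.
Hypotheses (Gg : g \in G) (pr_g : prime #[g]) (lt_lam : lam < #[g])
  (lt_l : l < #[g]).

Local Notation F := (afix 'P [set g]).

Lemma fix_mem x b : x \in F -> (x \in b ^^ g) = (x \in b).
Proof. by move/afix1P=> fx; rewrite -{1}fx mem_setactE. Qed.

Lemma fix_cls x : x \in F -> cls x ^^ g = cls x.
Proof. by move/afix1P=> fx; rewrite -clsJ ?fx. Qed.

(** The [lam] blocks through [x] and [y] are permuted by [g] and are fewer than its prime order, so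
    each is fixed. *)
Lemma fixed_block x y b :
  x \in F -> y \in F -> x != y -> b \in B -> x \in b -> y \in b -> b ^^ g = b.
Proof.
move=> Fx Fy ne Bb bx by_; pose S := [set b in B | (x \in b) && (y \in b)].
apply: (@small_fixed _ _ 'P^* g S); rewrite ?deg2 //; last by rewrite inE Bb bx.
rewrite cycle_subG; apply/astabsP => b'.
by rewrite !inE blockJ // !fix_mem.
Qed.

Lemma fixed_point x b :
  b \in B -> b ^^ g = b -> x \in b -> cls x ^^ g = cls x -> x \in F.
Proof.
move=> Bb fb bx fx; apply/afix1P.
apply: (@small_fixed _ _ 'P g (b :&: cls x)) => //.
- by rewrite cycle_subG; apply: setact_norm; rewrite setact_setI fb fx.
- by rewrite (card_meet Bb (cls_in x) bx (mem_cls x)).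
by rewrite inE bx mem_cls.
Qed.

(** Double counting: a block with two fixed points is fixed, and a fixed block meets a fixed class
    in fixed points only. *)
Lemma card_fixed_blocks x :
  x \in F ->
  (#|[set b in B | (x \in b) && (b ^^ g == b)]| * l.-1
     = lam * #|F :&: cls x|.-1)%N.
Proof.
move=> Fx; have -> : #|F :&: cls x|.-1 = #|(F :&: cls x) :\ x|.
  by rewrite (cardsD1 x (F :&: cls x)) inE Fx mem_cls.
rewrite [RHS]mulnC; apply/esym.
apply: (double_count (R := fun y (b : {set T}) => y \in b)) => [y|b].
  case/setD1P=> ne /setIP[Fy Dy]; rewrite -(@deg2 x y) 1?eq_sym //.
  apply: eq_card => b; rewrite !inE -!andbA; case Bb: (b \in B) => //=.
  case bx: (x \in b) => //=; rewrite andb_idl // => by_.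
  by apply/eqP/(@fixed_block x y); rewrite // eq_sym.
rewrite inE => /and3P[Bb bx /eqP fb].
rewrite -(card_meet Bb (cls_in x) bx (mem_cls x)) (cardsD1 x (b :&: cls x)).
rewrite inE bx mem_cls /=; apply: eq_card => y.
rewrite [LHS]inE !in_setD1 !in_setI; case: (y != x) => //=.
case Dy: (y \in cls x); case by_: (y \in b); rewrite ?andbF ?andbT //=.
by apply: (fixed_point Bb fb by_); rewrite (clsE (cls_in x) Dy) fix_cls.
Qed.

Lemma card_fixed_blocks_class x y :
  x \in F -> y \in F -> cls x != cls y ->
  (#|[set b in B | (x \in b) && ~~ [disjoint b & F :&: cls y]]| * l
     = lam * #|F :&: cls y|)%N.
Proof.
move=> Fx Fy ne; rewrite [RHS]mulnC; apply/esym.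
apply: (double_count (R := fun z (b : {set T}) => z \in b)) => [z|b].
  case/setIP=> Fz Dz; rewrite -(@deg2 x z).
    apply: eq_card => b; rewrite !inE -!andbA; congr [&& _, _ & _].
    by rewrite andb_idl // => zb; apply/pred0Pn; exists z; rewrite /= zb in_setI Fz.
  by apply: contraNneq ne => ->; rewrite (clsE (cls_in y) Dz).
rewrite inE => /and3P[Bb bx /pred0Pn[z /andP[/= bz /setIP[Fz Dz]]]].
have fb : b ^^ g = b.
  apply: (@fixed_block x z) => //; apply: contraNneq ne => ->.
  by rewrite (clsE (cls_in y) Dz).
rewrite -(card_meet Bb (cls_in y) bz Dz); apply: eq_card => w.
rewrite [LHS]inE !in_setI; case Dw: (w \in cls y); last by rewrite !andbF.
rewrite !andbT; case bw: (w \in b); rewrite ?andbF ?andbT //.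
by apply: (fixed_point Bb fb bw); rewrite (clsE (cls_in y) Dw) fix_cls.
Qed.

(* If [g] fixes the class of [x] pointwise, then it fixes all blocks meeting this
   class.  More than [lam] of these contain a given point [y] outside the class,
   hence also its image under [g]. *)
Lemma fixed_class_trivial x : ~~ (cls x \subset F).
Proof.
apply/negP => sDF; suff g1 : g = 1 by move: pr_g; rewrite g1 order1.
apply/permP=> y; rewrite perm1 -[g y]/('P%act y g); apply/eqP; apply/negPn/negP => nfix.
have nfix' : y != 'P%act y g by rewrite eq_sym.
have Dy : y \notin cls x.
  by apply: contra nfix => /(subsetP sDF)/afix1P->.
have := card_blocks_class (cls_in x) Dy.
suff : #|[set b in B | (y \in b) && ~~ [disjoint b & cls x]]| <= lam.
  move=> le_lam e; have : (lam * c <= lam * l)%N by rewrite -e leq_mul2r le_lam orbT.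
  by rewrite leq_mul2l leqNgt lt_lc orbF; case: (lam) lam_gt0.
rewrite -(deg2 nfix') subset_leq_card //; apply/subsetP=> b.
rewrite !inE => /and3P[Bb b_y /pred0Pn[z /andP[/= bz Dz]]]; rewrite Bb b_y /=.
have : 1 < #|b :&: cls x| by rewrite (card_meet Bb (cls_in x) bz Dz).
case/card_gt1P=> z1 [z2 [/setIP[b1 D1] /setIP[b2 D2] ne]].
have /setP/(_ ('P%act y g)) : b ^^ g = b.
  by apply: (@fixed_block z1 z2); rewrite ?(subsetP sDF).
by rewrite mem_setactE b_y => <-.
Qed.

End Fixed.

Lemma card_flags : #|flags B| = (#|B| * k)%N.
Proof.
rewrite -[LHS]muln1.
apply: (double_count (R := fun (f : T * {set T}) b => f.2 == b)) => [[x b]|b Bb].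
  rewrite inE /= => /andP[Bb bx]; rewrite -(cards1 b); apply: eq_card => b'.
  by rewrite !inE andbC eq_sym; apply: andb_idr => /eqP->.
rewrite -(card_block Bb) -(card_imset (mem b) (_ : injective (pair^~ b))).
  apply: eq_card => -[x b']; rewrite !inE /=; apply/andP/imsetP.
    by case=> /andP[_ b'x] /eqP <-; exists x.
  by case=> y b_y [-> ->]; rewrite Bb.
by move=> x y [].
Qed.

(** Otherwise an element of order [q] would permute all [#|B| * k] flags in cycles of length [q]. *)
Lemma cauchy_flag q :
  prime q -> q %| #|G| -> ~~ (q %| #|B| * k) ->
  exists g x b, [/\ g \in G, #[g] = q, b \in B, x \in b &
    'P%act x g = x /\ b ^^ g = b].
Proof.
move=> pr_q dvdG ndvd; have [g Gg og] := Cauchy pr_q dvdG.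
have actF : [acts <[g]>, on flags B | flag_action T].
  by apply: subset_trans (atrans_acts ftG); rewrite cycle_subG.
have /exists_inP[[x b]] : [exists f in flags B, flag_action T f g == f].
  apply: contraR ndvd => nfix; rewrite -card_flags -og.
  apply: prime_dvd_moved actF _; first by rewrite og.
  by move=> f Ff; apply: contra nfix => fixf; apply/exists_inP; exists f.
rewrite inE /= => /andP[Bb bx] /eqP[fx fb].
by exists g, x, b.
Qed.

(** * The kernel on the classes and its orbits of blocks *)

Local Notation K := 'C_G(Q | 'P^*).

(** The order of a Sylow [p]-subgroup is divisible by [p ^ 2], but its orbits on classes are shorter
    than [p ^ 2]. So it has an element of order [p] that fixes a class. *)
Lemma p_dvd_kernel p :
  prime p -> p ^ 2 %| #|T| -> d < p ^ 2 ->
  (forall z D, z \in G -> #[z] = p -> D \in Q -> D ^^ z = D -> z \in K) ->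
  p %| #|K|.
Proof.
move=> pr_p dvdT ltd fixK; have [P sylP] := Sylow_exists p G.
have [sPG pP _] := and3P sylP.
have dvdP : p ^ 2 %| #|P|.
  have dvdG : p ^ 2 %| #|G|.
    by apply: dvdn_trans dvdT _; have := atrans_dvd trans_points; rewrite cardsT.
  have <- : ((p ^ 2)`_p = p ^ 2)%N by apply: part_pnat_id; rewrite pnatX pnat_id.
  by rewrite (card_Hall sylP) partn_dvd.
have /card_gt0P[D QD] : 0 < #|Q| by rewrite card_Q ltnW.
have : 'C_P[D | 'P^*] != 1.
  apply: contraTneq (dvdP) => stab1; have := card_orbit_stab 'P^* P D.
  rewrite stab1 cards1 muln1 => <-; apply/negP => /dvdn_leq.
  have sO : orbit 'P^* P D \subset Q.
    by rewrite acts_sub_orbit // (subset_trans sPG).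
  move/(_ _); have := leq_ltn_trans (subset_leq_card sO).
  rewrite card_Q => /(_ _ ltd); rewrite ltnNge => /negP lt le.
  by apply: lt; apply: le; apply/card_gt0P; exists D; apply: orbit_refl.
move=> nt; have pC : p.-group 'C_P[D | 'P^*] by apply: pgroupS pP; apply: subsetIl.
have [_ dvdC _] := pgroup_pdiv pC nt.
have [z /setIP[Pz /astab1P fD] oz] := Cauchy pr_p dvdC.
have Kz : z \in K by apply: (fixK z D); rewrite ?(subsetP sPG).
by rewrite -oz; apply: order_dvdG.
Qed.

Lemma kernel_class x D : x \in K -> D \in Q -> D ^^ x = D.
Proof. by case/setIP=> _ /astabP fixQ; apply: fixQ. Qed.

Lemma kernelJ g : g \in G -> K :^ g = K.
Proof.
move=> Gg; rewrite conjIg conjGid //.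
by rewrite (normsP (astab_norm _ _)) // (subsetP actQ).
Qed.

Lemma kernel_trans x y D :
  no_blocks 'P 'N_G(D | 'P) D -> D \in Q -> x \in K -> y \in D ->
  'P%act y x != y -> [transitive K, on D | 'P].
Proof.
move=> prim QD Kx Dy nfix; pose X := orbit 'P K y.
have sXD : X \subset D.
  rewrite acts_sub_orbit //; apply/subsetP=> z Kz; apply: setact_norm.
  exact: kernel_class.
have XG g : g \in 'N_G(D | 'P) -> X ^^ g = orbit 'P K ('P%act y g).
  by case/setIP=> Gg _; rewrite -[LHS]/(setact _ _ _) setact_orbit kernelJ.
have blockX : is_block 'P 'N_G(D | 'P) X.
  apply/is_blockP=> g Ng neX; rewrite -setI_eq0; apply/eqP/setP=> w.
  rewrite !inE; apply/negP=> /andP[Xw]; rewrite -[setact _ _ _]/(X ^^ g) XG //.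
  move=> /orbit_eqP eqw; case: neX; rewrite -[setact _ _ _]/(X ^^ g) XG // -eqw.
  by move/orbit_eqP: Xw => ->.
have := prim X sXD; rewrite blockX => /contraTF/(_ isT)/negbT.
have -> : 1 < #|X|.
  apply/card_gt1P; exists ('P%act y x), y.
  by rewrite orbit_refl mem_orbit.
rewrite -leqNgt => leDX; apply/imsetP; exists y => //; apply/esym/eqP.
by rewrite eqEcard sXD.
Qed.

(** By flag-transitivity this number is the same for all flags [(x, b)], see [multE]. *)
Definition mult x b := #|[set b' in B | (x \in b') && (b' \in orbit 'P^* K b)]|.

Lemma orbitKJ b g : g \in G ->
  orbit 'P^* K (b ^^ g) = ('P^*)^*%act (orbit 'P^* K b) g.
Proof. by move=> Gg; rewrite -[RHS]/(setact _ _ _) setact_orbit kernelJ. Qed.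

Lemma multE x b x' b' :
  b \in B -> x \in b -> b' \in B -> x' \in b' -> mult x b = mult x' b'.
Proof.
move=> Bb bx Bb' bx'; have [g Gg [<- <-]] := flag_trans Bb bx Bb' bx'.
rewrite /mult -[LHS](card_setact 'P^* _ g); apply: eq_card => b1.
rewrite -(actKV 'P^* g b1); move: ('P^*%act b1 _) => b0.
rewrite [LHS]mem_setactE !inE blockJ // orbitKJ //.
by congr [&& _, _ & _]; apply/esym; apply: mem_setactE.
Qed.

(** The [K]-orbits of blocks split [S] into parts of size [mult x b]. *)
Lemma mult_dvd x b (S : {set {set T}}) :
  b \in B -> x \in b -> S \subset [set b in B | x \in b] ->
  (forall b1 h, h \in K -> b1 \in S -> x \in b1 ^^ h -> b1 ^^ h \in S) ->
  mult x b %| #|S|.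
Proof.
move=> Bb bx sS satS; apply: (@uniform_fibers _ _ _ (orbit 'P^* K)) => b1 Sb1.
have := subsetP sS b1 Sb1; rewrite inE => /andP[Bb1 b1x].
rewrite (multE Bb bx Bb1 b1x); apply: eq_card => b2; rewrite !inE.
apply/andP/and3P => [[Sb2 /eqP eqO] | [Bb2 b2x O2]].
  have := subsetP sS b2 Sb2; rewrite inE => /andP[-> ->]; split=> //.
  by rewrite -eqO orbit_refl.
have /orbit_eqP eqO := O2; rewrite eqO; split=> //.
by have [h Kh eh] := orbitP O2; rewrite -eh satS ?eh.
Qed.

Lemma mult_dvd_r x b : b \in B -> x \in b -> mult x b %| r.
Proof.
move=> Bb bx; rewrite -(deg1 x); apply: mult_dvd => // b1 h /setIP[Gh _].
by rewrite !inE blockJ // => /andP[-> _] ->.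
Qed.

Lemma mult_dvd_class x b D :
  b \in B -> x \in b -> D \in Q ->
  mult x b %| #|[set b in B | (x \in b) && ~~ [disjoint b & D]]|.
Proof.
move=> Bb bx QD; apply: mult_dvd => // [|b1 h Kh].
  by apply/subsetP=> b1; rewrite !inE => /and3P[-> ->].
have Gh : h \in G by case/setIP: Kh.
rewrite !inE blockJ // => /and3P[-> _ meet] -> /=.
by rewrite -(kernel_class Kh QD) disjoint_setact.
Qed.

(** Counts incidences between the class of [x] and the blocks of the orbit; [K] fixes the class, so
    each of these blocks meets it in [l] points. *)
Lemma card_orbitK x b :
  b \in B -> x \in b -> [transitive K, on cls x | 'P] ->
  (#|orbit 'P^* K b| * l = c * mult x b)%N.
Proof.
move=> Bb bx trK; rewrite -(card_class (cls_in x)); apply/esym.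
apply: (double_count (R := fun y (b' : {set T}) => y \in b')) => [y Dy | b1 O1].
  have [h Kh ->] := atransP2 trK (mem_cls x) Dy.
  have Gh : h \in G by case/setIP: Kh.
  have eO : orbit 'P^* K (b ^^ h) = orbit 'P^* K b by apply: orbit_act.
  rewrite (@multE x b ('P%act x h) (b ^^ h)) ?blockJ ?mem_setactE //.
  rewrite /mult eO; apply: eq_card => b2; rewrite !inE.
  apply/andP/and3P => [[O2 xb2] | [_ xb2 O2]]; split=> //.
  by have [h2 /setIP[Gh2 _] <-] := orbitP O2; rewrite blockJ.
have [h Kh <-] := orbitP O1; have Gh : h \in G by case/setIP: Kh.
rewrite -(@card_meet (b ^^ h) (cls x) ('P%act x h)) ?blockJ ?cls_in ?mem_setactE //.
  by apply: eq_card => y; rewrite !inE andbC.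
by rewrite -(kernel_class Kh (cls_in x)) mem_setactE.
Qed.

(** [K] is normal and [G] is transitive on blocks, so all [K]-orbits on [B] have the same size. *)
Lemma card_orbitK_dvd b : b \in B -> #|orbit 'P^* K b| %| #|B|.
Proof.
move=> Bb; apply: (@uniform_fibers _ _ _ (orbit 'P^* K)) => b1 Bb1.
have [x [x' [bx b1x']]] : exists x x', x \in b /\ x' \in b1.
  have /card_gt0P[x bx] : 0 < #|b| by rewrite block_nonempty.
  have /card_gt0P[x' b1x'] : 0 < #|b1| by rewrite block_nonempty.
  by exists x, x'.
have [g Gg [_ <-]] := flag_trans Bb bx Bb1 b1x'.
have -> : #|orbit 'P^* K b| = #|orbit 'P^* K (b ^^ g)|.
  by rewrite orbitKJ //; apply/esym/card_setact.
apply: eq_card => b2; rewrite inE; apply/andP/idP => [[_ /eqP <-] | O2].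
  exact: orbit_refl.
have [h Kh <-] := orbitP O2; have Gh : h \in G by case/setIP: Kh.
by rewrite !blockJ // Bb orbit_act.
Qed.

Lemma acts_fixed_class g x :
  g \in G -> 'P%act x g = x -> [acts <[g]>, on cls x | 'P].
Proof.
move=> Gg fx; rewrite cycle_subG; apply: setact_norm.
by apply: fix_cls => //; apply/afix1P.
Qed.

(** * Excluding [lambda = 5], [k = 225] *)

Section Triple.

Hypotheses (ek : k = 225) (elam : lam = 5) (er : r = 275) (el : l = 3)
  (ec : c = 111) (ed : d = 111) (eB : (#|B| * k = c * d * r)%N).

Lemma triple_blocks : (#|B| = 11 * 37 * 37)%N.
Proof. by move: eB; rewrite ek ec ed er; clear; lia. Qed.

(* The number of fixed points in the class of [x] is odd and divisible by 3, so
   [6 * #[g]] divides the number of moved ones. *)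
Lemma triple_fixed g x y :
  g \in G -> #[g] = 19 \/ #[g] = 37 ->
  'P%act x g = x -> 'P%act y g = y -> cls x = cls y.
Proof.
move=> Gg og fx fy; apply/eqP/negPn/negP => ne.
have pr_g : prime #[g] by case: og => ->.
have lt_lam : lam < #[g] by rewrite elam; case: og => ->.
have lt_l : l < #[g] by rewrite el; case: og => ->.
have Fx : x \in afix 'P [set g] by apply/afix1P.
have Fy : y \in afix 'P [set g] by apply/afix1P.
have := card_fixed_blocks Gg pr_g lt_lam lt_l Fx.
have ne' : cls y != cls x by rewrite eq_sym.
have := card_fixed_blocks_class Gg pr_g lt_lam lt_l Fy Fx ne'.
have /dvdnP[t] := prime_dvd_moved_compl pr_g (acts_fixed_class Gg fx).
have moved : 0 < #|cls x :\: afix 'P [set g]|.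
  by rewrite card_gt0 setD_eq0 fixed_class_trivial.
have := cardsID (afix 'P [set g]) (cls x); rewrite (card_class (cls_in x)) setIC ec.
have : 0 < #|afix 'P [set g] :&: cls x|.
  by apply/card_gt0P; exists x; rewrite inE Fx mem_cls.
move: moved; rewrite el elam; move: #|_ :\: _| #|_ :&: _| => M phi.
move: #|_| #|_| => n n'; case: og => ->; clear; lia.
Qed.

(** An element of order [19] would fix a flag [(x, b)]. As [19] does not divide [222], it would fix
    one of the [222] points of [b] outside the class of [x], against [triple_fixed]. *)
Lemma triple_not19 : ~~ (19 %| #|G|).
Proof.
apply/negP=> dvd19; have [] := cauchy_flag _ dvd19; first by [].
  rewrite triple_blocks ek; apply/negP => /dvdnP[m]; clear; lia.
move=> g [x [b [Gg og Bb bx [fx fb]]]].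
have og' : #[g] = 19 \/ #[g] = 37 by left.
pose S := b :\: cls x; have cS : #|S| = 222.
  have := cardsID (cls x) b; rewrite (card_meet Bb (cls_in x) bx (mem_cls x)).
  by rewrite (card_block Bb) ek el -/S; clear; lia.
have actS : [acts <[g]>, on S | 'P].
  apply: actsD; last exact: acts_fixed_class.
  by rewrite cycle_subG; apply: setact_norm.
have pr_g : prime #[g] by rewrite og.
have := prime_dvd_moved_compl pr_g actS; rewrite og => dvdS.
have : 0 < #|S :&: afix 'P [set g]|.
  have := cardsID (afix 'P [set g]) S; rewrite cS.
  by have /dvdnP[m ->] := dvdS; clear; lia.
case/card_gt0P=> y /setIP[/setDP[by_ Dy] /afix1P fy].
by move: Dy; rewrite (triple_fixed Gg og' fx fy) mem_cls.
Qed.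

(** [275 %| 555 * n] means [55 %| n], and [111 < 2 * 56]. *)
Lemma triple_no_blocks_classes : no_blocks 'P^* G Q.
Proof.
apply: no_blocks_classes => n n0; rewrite er elam ec ed => /dvdnP[m].
by move: n0; clear; lia.
Qed.

(** Otherwise [z] has one or two nontrivial cycles on the [111] classes, and Jordan's argument makes
    [38] divide [#|G|], against [triple_not19]. *)
Lemma triple_kernel z D :
  z \in G -> #[z] = 37 -> D \in Q -> D ^^ z = D -> z \in K.
Proof.
move=> Gz oz QD fD; have pr_z : prime #[z] by rewrite oz.
have actz : [acts <[z]>, on Q | 'P^*] by rewrite (subset_trans _ actQ) // cycle_subG.
have dvd38 : 38 %| #|G| -> z \in K.
  by move=> dvdG; case/negP: triple_not19; apply: dvdn_trans dvdG.
have := prime_dvd_moved_compl pr_z actz; rewrite oz => /dvdnP[m cM].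
have lt3 : m < 3.
  have : #|Q :\: afix 'P^* [set z]| < #|Q|.
    apply: proper_card; apply/properP; split; first exact: subsetDl.
    by exists D => //; rewrite inE negb_and negbK; apply/orP; left; apply/afix1P.
  by rewrite cM card_Q ed; clear; lia.
case: m lt3 cM => [|[|[|]]] // _ cM.
- rewrite inE Gz; apply/astabP=> E QE; apply/afix1P.
  by move/eqP: cM; rewrite cards_eq0 setD_eq0 => /subsetP/(_ E QE).
- apply: dvd38; have := jordan_cycle actQ triple_no_blocks_classes Gz pr_z.
  by rewrite oz card_Q ed cM mul1n => /(_ erefl isT)/andP[].
apply: dvd38; have := jordan_two_cycles actQ triple_no_blocks_classes Gz pr_z.
by rewrite oz card_Q ed cM => /(_ isT erefl erefl).
Qed.

Lemma triple_false : False.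
Proof.
have dvdK : 37 %| #|K|.
  apply: p_dvd_kernel triple_kernel => //; last by rewrite ed.
  by rewrite card_points ec ed; apply/dvdnP; exists 9.
have [x Kx ox] := Cauchy (isT : prime 37) dvdK.
have Gx : x \in G by case/setIP: Kx.
have pr_x : prime #[x] by rewrite ox.
have lt_lam : lam < #[x] by rewrite elam ox.
have lt_l : l < #[x] by rewrite el ox.
have fixp b y : b \in B -> b ^^ x = b -> y \in b -> 'P%act y x = y.
  move=> Bb fb b_y; have fD := kernel_class Kx (cls_in y).
  by have /afix1P := fixed_point pr_x lt_l Bb fb b_y fD.
(* A fixed point comes with others in its class. A block through two of them is fixed pointwise but
   leaves the class, against [triple_fixed]. *)
have nofix y : 'P%act y x != y.
  apply/negP => /eqP fy; have Fy : y \in afix 'P [set x] by apply/afix1P.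
  have dvdD := prime_dvd_moved_compl pr_x (acts_fixed_class Gx fy).
  have := cardsID (afix 'P [set x]) (cls y); rewrite (card_class (cls_in y)) ec => cD.
  have : 1 < #|cls y :&: afix 'P [set x]|.
    have : 0 < #|cls y :&: afix 'P [set x]|.
      by apply/card_gt0P; exists y; rewrite in_setI mem_cls.
    by move: cD dvdD; rewrite ox => cD /dvdnP[m cM]; move: cD; rewrite cM; clear; lia.
  rewrite (cardsD1 y) in_setI mem_cls Fy ltnS.
  case/card_gt0P=> z /setD1P[ne /setIP[Dz Fz]].
  have [b [Bb b_y bz]] := block_at2 y z.
  have fb : b ^^ x = b.
    by apply: (fixed_block Gx pr_x lt_lam Fy Fz); rewrite // eq_sym.
  have : 0 < #|b :\: cls y|.
    have := cardsID (cls y) b; rewrite (card_meet Bb (cls_in y) b_y (mem_cls y)).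
    by rewrite (card_block Bb) ek el; clear; lia.
  case/card_gt0P=> w /setDP[bw Dw]; case/negP: Dw.
  have ox' : #[x] = 19 \/ #[x] = 37 by right.
  by rewrite (triple_fixed Gx ox' fy (fixp b w Bb fb bw)).
have /card_gt0P[a _] : 0 < #|T| by rewrite card_points ec ed.
pose a' := 'P%act a x; have [b [Bb ba ba']] := block_at2 a a'.
have nob : b ^^ x != b by apply: contra (nofix a) => /eqP fb; apply/eqP/(fixp b).
have primD : no_blocks 'P 'N_G(cls a' | 'P) (cls a').
  apply: no_blocks_class => // n n0; rewrite er elam ec => /dvdnP[m].
  by move: n0; clear; lia.
have trK := kernel_trans primD (cls_in a') Kx (mem_cls a') (nofix a').
have := card_orbitK Bb ba' trK; have /dvdnP[m] := card_orbitK_dvd Bb.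
rewrite triple_blocks ec el.
(* [185 = lam * c / l] blocks through [a'] meet a given other class, and [r = 275]. The value [5]
   fails below: the orbit would have [185] blocks, which does not divide [11 * 37 ^ 2]. *)
have : mult a' b %| 5.
  have [D QD Da] : exists2 D, D \in Q & a' \notin D.
    have /card_gt0P[D /setD1P[ne QD]] : 0 < #|Q :\ cls a'|.
      by have := cardsD1 (cls a') Q; rewrite cls_in card_Q ed add1n => -[<-].
    by exists D => //; apply: contra ne => /(clsE QD) ->.
  have := mult_dvd_class Bb ba' QD; have := card_blocks_class QD Da.
  have -> : (lam * c = 185 * l)%N by rewrite elam ec el.
  move/eqP; rewrite eqn_pmul2r ?el // => /eqP-> dvd185.
  have := mult_dvd_r Bb ba'; rewrite er => dvd275.
  have -> : 5 = gcdn 185 275 by [].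
  by rewrite dvdn_gcd dvd185.
rewrite dvdn_divisors // !inE => /orP[] /eqP t5 eO eO'; last first.
  by move: eO eO'; rewrite t5; move: #|orbit _ _ _| => O; clear; lia.
(* Both [b] and its image under [x] contain [a'], and they lie in one [K]-orbit. *)
case/eqP: nob; have le1 : mult a' b <= 1 by rewrite t5.
apply: (card_le1_eqP le1); rewrite inE ?blockJ // ?Bb ?ba' ?orbit_refl //=.
by rewrite mem_setactE ba mem_orbit.
Qed.

End Triple.

(** * Excluding [lambda = 2], [k = 12] and [k = 24] *)

Section Pair.

Variable p : nat.
Hypotheses (ep : p = 5 \/ p = 11) (ek : k = (2 * p + 2)%N) (elam : lam = 2)
  (er : r = (4 * p - 2)%N) (el : l = 2) (ec : c = (2 * p)%N)
  (ed : d = (2 * p)%N) (eB : (#|B| * k = c * d * r)%N).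

Let pr_p : prime p.
Proof. by case: ep => ->. Qed.

(** The fixed block meets [p + 1] classes and misses [p - 1]; [g] permutes both sets, and each is
    smaller than its order. *)
Lemma pair_fixed_classes g b D :
  prime #[g] -> #[g] = p.+2 -> g \in G -> b \in B -> b ^^ g = b -> D \in Q ->
  D ^^ g = D.
Proof.
move=> pr_g og Gg Bb fb QD; pose Z := [set E in Q | ~~ [disjoint b & E]].
have cZ : #|Z| = p.+1.
  by have := card_classes_block Bb; rewrite -/Z el ek; clear; lia.
have actQg : [acts <[g]>, on Q | 'P^*] by rewrite (subset_trans _ actQ) // cycle_subG.
have actZ : [acts <[g]>, on Z | 'P^*].
  rewrite cycle_subG; apply/astabsP => E; rewrite !inE classJ //.
  have -> : [disjoint b & E ^^ g] = [disjoint b ^^ g & E ^^ g] by rewrite fb.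
  by rewrite disjoint_setact.
have [ZD | ZD] := boolP (D \in Z).
  by apply: (small_fixed pr_g actZ); rewrite // cZ og.
apply: (small_fixed pr_g (S := Q :\: Z)); last by rewrite inE ZD.
  by apply: actsD.
rewrite cardsD (setIidPr _) ?cZ ?card_Q ?ed ?og; first by clear; lia.
by apply/subsetP=> E; rewrite inE => /andP[].
Qed.

(** An element of order [p + 2] would fix a flag, hence all classes, and [p - 2] points in each.
    Counting its fixed blocks through [x] in two ways gives [2 * (2 * p * (p - 2) - 1) = 2 * (p - 3)
    * (2 * p + 1)], but the sides differ by [2 * (p + 2)]. *)
Lemma pair_not_p2 : ~~ (p.+2 %| #|G|).
Proof.
have pr_p2 : prime p.+2 by case: ep => ->.
apply/negP => dvdG; have [] := cauchy_flag pr_p2 dvdG.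
  rewrite eB ec ed er; apply/negP => /dvdnP[m].
  by case: ep => ->; clear; lia.
move=> g [x [b [Gg og Bb bx [fx fb]]]]; pose F := afix 'P [set g].
have Fx : x \in F by apply/afix1P.
have pr_g : prime #[g] by rewrite og.
have lt_lam : lam < #[g] by rewrite elam og; case: ep => ->.
have lt_l : l < #[g] by rewrite el og; case: ep => ->.
have fQ D : D \in Q -> D ^^ g = D by apply: (pair_fixed_classes pr_g og Gg Bb fb).
have fixB b' : b' \in B -> b' ^^ g = b' -> b' \subset F.
  move=> Bb' fb'; apply/subsetP=> y b'y.
  exact: (fixed_point pr_g lt_l Bb' fb' b'y (fQ _ (cls_in y))).
have cFD D : D \in Q -> (#|D :&: F| = p - 2)%N.
  move=> QD; have [y Dy] := class_nonempty QD.
  have actD : [acts <[g]>, on D | 'P].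
    by rewrite cycle_subG; apply: setact_norm; apply: fQ.
  have : 0 < #|D :\: F|.
    by rewrite card_gt0 setD_eq0 -(clsE QD Dy) fixed_class_trivial.
  have := cardsID F D; rewrite (card_class QD) ec.
  have := prime_dvd_moved_compl pr_g actD; rewrite og -/F => /dvdnP[m ->].
  by case: ep => ->; clear; lia.
have cF : #|F| = (2 * p * (p - 2))%N.
  rewrite -ed -card_Q -[LHS]muln1.
  apply: (double_count (R := fun x (D : {set T}) => x \in D)) => [y Fy | D QD].
    rewrite -(cards1 (cls y)); apply: eq_card => D; rewrite !inE.
    by apply/andP/eqP => [[QD Dy] | ->]; rewrite ?(clsE QD Dy) ?cls_in ?mem_cls.
  by rewrite -(cFD D QD); apply: eq_card => y; rewrite [LHS]inE in_setI andbC.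
have := card_fixed_blocks Gg pr_g lt_lam lt_l Fx.
rewrite el elam setIC (cFD _ (cls_in x)).
have : (#|F :\ x| * 2 = #|[set b in B | (x \in b) && (b ^^ g == b)]| * k.-1)%N.
  apply: (double_count (R := fun y (b : {set T}) => y \in b)).
    move=> y /setD1P[ne Fy].
    rewrite -elam -(@deg2 x y) 1?eq_sym //; apply: eq_card => b'; rewrite !inE.
    apply/andP/and3P => [[/and3P[-> -> _] ->] | [Bb' b'x b'y]] //.
    rewrite Bb' b'x b'y /=; split=> //; apply/eqP.
    by apply: (fixed_block Gg pr_g lt_lam Fx Fy); rewrite // eq_sym.
  move=> b'; rewrite inE => /and3P[Bb' b'x /eqP fb'].
  have := cardsD1 x b'; rewrite b'x (card_block Bb') add1n => -> /=.
  apply: eq_card => y; rewrite [LHS]inE !in_setD1 -andbA; congr (_ && _).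
  by rewrite andb_idl // => /(subsetP (fixB _ Bb' fb')).
have := cardsD1 x F; rewrite Fx cF ek; move: #|_| #|_| => n1 n2.
by case: ep => ->; clear; lia.
Qed.

(** The divisibility amounts to [2 * p - 1 %| n]. *)
Lemma pair_no_blocks_classes : no_blocks 'P^* G Q.
Proof.
apply: no_blocks_classes => n n0; rewrite er elam ec ed => /dvdnP[m].
by case: ep => ->; move: n0; clear; lia.
Qed.

Lemma pair_no_blocks_class D : D \in Q -> no_blocks 'P 'N_G(D | 'P) D.
Proof.
apply: no_blocks_class => n n0; rewrite er elam ec => /dvdnP[m].
by case: ep => ->; move: n0; clear; lia.
Qed.

(** As [z] fixes [D], it moves either no class or a single cycle of [p] classes; [jordan_cycle] and
    [pair_not_p2] rule out the cycle. *)
Lemma pair_kernel z D :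
  z \in G -> #[z] = p -> D \in Q -> D ^^ z = D -> z \in K.
Proof.
move=> Gz oz QD fD; have pr_z : prime #[z] by rewrite oz.
have actz : [acts <[z]>, on Q | 'P^*] by rewrite (subset_trans _ actQ) // cycle_subG.
have := prime_dvd_moved_compl pr_z actz; rewrite oz => /dvdnP[m cM].
have lt2 : m < 2.
  have : #|Q :\: afix 'P^* [set z]| < #|Q|.
    apply: proper_card; apply/properP; split; first exact: subsetDl.
    by exists D => //; rewrite inE negb_and negbK; apply/orP; left; apply/afix1P.
  by rewrite cM card_Q ed ltn_pmul2r // prime_gt0.
case: m lt2 cM => [|[|]] // _ cM.
  rewrite inE Gz; apply/astabP=> E QE; apply/afix1P.
  by move/eqP: cM; rewrite cards_eq0 setD_eq0 => /subsetP/(_ E QE).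
have := jordan_cycle actQ pair_no_blocks_classes Gz pr_z.
rewrite oz card_Q ed cM mul1n => /(_ erefl).
have -> : p.+1 < 2 * p by case: ep => ->.
by move=> /(_ isT)/andP[_]; rewrite (negPf pair_not_p2).
Qed.

Lemma pair_false : False.
Proof.
have p2 : 2 < p by case: ep => ->.
have p_gt0 := prime_gt0 pr_p.
have dvdK : p %| #|K|.
  apply: p_dvd_kernel pair_kernel => //.
    by rewrite card_points ec ed; apply/dvdnP; exists 4; clear; lia.
  by rewrite ed; case: ep => ->.
have [x Kx ox] := Cauchy pr_p dvdK.
have Gx : x \in G by case/setIP: Kx.
have pr_x : prime #[x] by rewrite ox.
have lt_lam : lam < #[x] by rewrite elam ox.
have lt_l : l < #[x] by rewrite el ox.
have fixp b y : b \in B -> b ^^ x = b -> y \in b -> 'P%act y x = y.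
  move=> Bb fb b_y; have fD := kernel_class Kx (cls_in y).
  by have /afix1P := fixed_point pr_x lt_l Bb fb b_y fD.
(* If [y] were fixed, [x] would have exactly one nontrivial cycle on the class of [y], and
   [jordan_cycle] there would contradict [pair_not_p2]. *)
have nofix y : 'P%act y x != y.
  apply/negP => /eqP fy; have Fy : y \in afix 'P [set x] by apply/afix1P.
  have QD := cls_in y.
  have dvdD := prime_dvd_moved_compl pr_x (acts_fixed_class Gx fy).
  have moved : 0 < #|cls y :\: afix 'P [set x]|.
    by rewrite card_gt0 setD_eq0 fixed_class_trivial.
  have fixed : 0 < #|cls y :&: afix 'P [set x]|.
    by apply/card_gt0P; exists y; rewrite in_setI mem_cls.
  have cM : #|cls y :\: afix 'P [set x]| = #[x].
    have := cardsID (afix 'P [set x]) (cls y); rewrite (card_class QD) ec ox.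
    move: dvdD moved fixed; rewrite ox => /dvdnP[m ->].
    case: m => [|[|m]] //; first by rewrite mul1n.
    by move: #|_| => n; clear; lia.
  have Nx : x \in 'N_G(cls y | 'P).
    by apply/setIP; split=> //; apply: setact_norm; apply: kernel_class.
  have actD : [acts 'N_G(cls y | 'P), on cls y | 'P] by apply: subsetIr.
  have := jordan_cycle actD (pair_no_blocks_class QD) Nx pr_x cM.
  rewrite ox (card_class QD) ec; have -> : p.+1 < 2 * p by case: ep => ->.
  move=> /(_ isT)/andP[_ dvdN]; case/negP: pair_not_p2.
  by apply: dvdn_trans dvdN _; rewrite cardSg ?subsetIl.
have /card_gt0P[a _] : 0 < #|T| by rewrite card_points ec ed !muln_gt0 p_gt0.
pose D := cls a; have QD : D \in Q := cls_in a; have Da : a \in D := mem_cls a.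
have xD y : ('P%act y x \in D) = (y \in D).
  by rewrite -{1}(kernel_class Kx QD) mem_setactE.
have xVD y : ('P%act y x^-1 \in D) = (y \in D).
  by rewrite -xD actKV.
have trK := kernel_trans (pair_no_blocks_class QD) QD Kx Da (nofix a).
(* The multiplicity divides [r = 4 * p - 2] and the number [2 * p] of blocks through [a] that meet
   another class. *)
have le2 b : b \in B -> a \in b -> mult a b <= 2.
  move=> Bb ba; apply: dvdn_leq => //.
  have [E QE Ea] : exists2 E, E \in Q & a \notin E.
    have /card_gt0P[E /setD1P[ne QE]] : 0 < #|Q :\ D|.
      have := cardsD1 D Q; rewrite QD card_Q ed; move: #|_| => n.
      by move: p2; clear; lia.
    by exists E => //; apply: contra ne => /(clsE QE) <-.
  have := mult_dvd_class Bb ba QE; have := card_blocks_class QE Ea.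
  have -> : (lam * c = 2 * p * l)%N by rewrite elam ec el; clear; lia.
  move/eqP; rewrite eqn_pmul2r ?el // => /eqP-> dvd1.
  have := mult_dvd_r Bb ba; rewrite er => dvd2.
  have -> : 2 = (2 * (2 * p) - (4 * p - 2))%N by move: p_gt0; clear; lia.
  by apply: dvdn_sub => //; apply: dvdn_mull.
pose A := D :\ a.
have cA : #|A| = (2 * p).-1.
  by have := cardsD1 a D; rewrite Da (card_class QD) ec => ->.
have third b y z : b \in B -> a \in b -> y \in b -> z \in b ->
    y \in A -> z \in A -> y = z.
  move=> Bb ba b_y bz /setD1P[ya Dy] /setD1P[za Dz].
  have c1 : #|(b :&: D) :\ a| <= 1.
    have := cardsD1 a (b :&: D); rewrite (card_meet Bb QD ba Da) in_setI ba Da el.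
    by move: #|_| => n; clear; lia.
  by apply: (card_le1_eqP c1); rewrite in_setD1 in_setI ?ya ?za ?b_y ?bz.
(* The relation [paired] identifies the points of [A] in pairs, one of them being
   [a^x] and [a^(x^-1)], although [A] has odd size. *)
pose paired y z := [exists b in B, [&& a \in b, y \in b &
  [exists b' in B, [&& a \in b', z \in b' & b' \in orbit 'P^* K b]]]].
pose h y := [set z in A | paired y z].
have hP y z : reflect (exists b b', [/\ b \in B, a \in b, y \in b &
    [/\ b' \in B, a \in b', z \in b' & b' \in orbit 'P^* K b]]) (paired y z).
  apply: (iffP exists_inP) => [[b Bb /and3P[ba b_y /exists_inP[b' Bb' /and3P[]]]] | ].
    by exists b, b'.
  case=> b [b' [Bb ba b_y [Bb' b'a b'z O']]]; exists b => //.
  by rewrite ba b_y; apply/exists_inP; exists b'; rewrite // b'a b'z.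
have hE y z : (z \in h y) = (z \in A) && paired y z by rewrite in_set.
(* An element fixing [a] and taking a block through [y] to one through [z] takes [y] to [z] by
   [third]; it respects [paired] because [K] is normal. *)
have le_h y z : y \in A -> z \in A -> #|h y| <= #|h z|.
  move=> Ay Az; have [b1 [Bb1 b1a b1y]] := block_at2 a y.
  have [b [Bb ba bz]] := block_at2 a z.
  have [g Gg [fa eb]] := flag_trans Bb1 b1a Bb ba.
  have gA w : ('P%act w g \in A) = (w \in A).
    rewrite !in_setD1 -{1}fa (inj_eq (act_inj 'P g)); congr (_ && _).
    have <- : D ^^ g = D by rewrite -clsJ ?fa.
    by rewrite mem_setactE /D -clsJ ?fa.
  have eyz : 'P%act y g = z.
    by apply: (third b); rewrite // ?gA // -eb mem_setactE.
  rewrite -(card_setact 'P _ g); apply: subset_leq_card; apply/subsetP=> w.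
  rewrite mem_setactV hE => /andP[Aw /hP[b2 [b3 [B2 b2a b2y [B3 b3a b3w O3]]]]].
  rewrite hE; apply/andP; split; first by rewrite -(actKV 'P g w) gA.
  apply/hP; exists (b2 ^^ g), (b3 ^^ g).
  have ag b0 : (a \in b0 ^^ g) = (a \in b0) by rewrite -{1}fa mem_setactE.
  rewrite !blockJ // !ag -eyz !mem_setactE; split=> //; split=> //.
    by rewrite mem_setactV.
  by rewrite orbitKJ // mem_setactE.
pose a1 := 'P%act a x; pose a2 := 'P%act a x^-1.
have Aa1 : a1 \in A by rewrite in_setD1 nofix xD.
have a2a : a2 != a by rewrite -(inj_eq (act_inj 'P x)) actKV eq_sym nofix.
have Aa2 : a2 \in A by rewrite in_setD1 a2a xVD.
have ne12 : a1 != a2.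
  rewrite -(inj_eq (act_inj 'P x)) actKV -[X in X != _]actM; apply/negP => /eqP fa.
  case/eqP: (nofix a); have : x \in <[x ^+ 2]>.
    (* The order [p] is odd, so if [x ^+ 2] fixes [a], so does [x]. *)
    have /eqP <- : generator <[x]> (x ^+ 2); last exact: cycle_id.
    by rewrite generator_coprime ox prime_coprime // dvdn_prime2 // gtn_eqF.
  case/cycleP=> i ->; rewrite actX; elim: i => //= i ->.
  by rewrite expgS expg1.
have ha1 : h a1 = [set a1; a2].
  apply/setP=> z; rewrite hE in_set2; apply/andP/orP.
    case=> Az /hP[b [b' [Bb ba ba1 [Bb' b'a b'z O']]]].
    have Bbx : b ^^ x^-1 \in B by rewrite blockJ ?groupV.
    have bxa : a \in b ^^ x^-1 by rewrite mem_setactV invgK.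
    have neb : b ^^ x^-1 != b.
      rewrite -(inj_eq (act_inj 'P^* x)) actKV eq_sym.
      by apply: contra (nofix a) => /eqP fb; apply/eqP/(fixp b).
    have Obx : b ^^ x^-1 \in orbit 'P^* K b by rewrite mem_orbit ?groupV.
    have [eb | neb'] := eqVneq b' b.
      by left; apply/eqP/(third b); rewrite // -eb.
    (* By [le2] there is no third block through [a] in the orbit. The second points in [D] of the
       two blocks are [a1] and [a2]. *)
    have eb : b' = b ^^ x^-1.
      apply: contraTeq (le2 b Bb ba) => neb2; rewrite -ltnNge.
      apply: leq_trans (_ : #|[set b; b ^^ x^-1; b']| <= _).
        by rewrite setUC cardsU1 !inE negb_or neb' neb2 cards2 eq_sym neb.
      apply: subset_leq_card; apply/subsetP=> b2; rewrite !inE -orbA.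
      by case/or3P=> /eqP->; rewrite ?Bb ?ba ?orbit_refl ?Bbx ?bxa ?Obx ?Bb' ?b'a ?O'.
    right; apply/eqP/(third b'); rewrite // eb mem_setactE //.
  have [b [Bb ba ba1]] := block_at2 a a1.
  case=> /eqP->; split=> //; apply/hP.
    by exists b, b; rewrite orbit_refl.
  exists b, (b ^^ x^-1); rewrite blockJ ?groupV // mem_setactE mem_orbit ?groupV //.
  by rewrite mem_setactV invgK.
have ch y : y \in A -> #|h y| = 2.
  move=> Ay; have <- : #|h a1| = 2 by rewrite ha1 cards2 ne12.
  by apply/eqP; rewrite eqn_leq !le_h.
have hyy y : y \in A -> y \in h y.
  move=> Ay; rewrite hE Ay; apply/hP; have [b [Bb ba b_y]] := block_at2 a y.
  by exists b, b; rewrite orbit_refl.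
have hsym y z : y \in A -> z \in h y -> y \in h z.
  rewrite !hE => -> /andP[_ /hP[b [b' [Bb ba b_y [Bb' b'a b'z O']]]]].
  by apply/hP; exists b', b; rewrite orbit_sym.
(* The sets [h y] partition [A] into pairs. *)
have : 2 %| #|A|.
  apply: (uniform_fibers (f := h)) => y Ay; rewrite -(ch y Ay); apply: eq_card => z.
  rewrite inE; apply/andP/idP => [[Az /eqP <-] | hz]; first exact: hyy.
  have Az : z \in A by move: hz; rewrite hE => /andP[].
  split=> //; have [-> // | ne] := eqVneq z y.
  have e2 w w' : w \in A -> w \in h w -> w' \in h w -> w != w' -> h w = [set w; w'].
    move=> Aw ww ww' ne'; apply/esym/eqP.
    by rewrite eqEcard subUset !sub1set ww ww' ch // cards2 ne'.
  have ez := e2 z y Az (hyy z Az) (hsym y z Ay hz) ne.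
  have ne' : y != z by rewrite eq_sym.
  by apply/eqP; rewrite ez (e2 y z Ay (hyy y Ay) hz ne') setUC.
by rewrite cA => /dvdnP[m]; move: p_gt0; clear; lia.
Qed.

End Pair.

End Configuration.

(** * Arithmetic of the parameters *)

Import Order.TTheory GRing.Theory Num.Theory.

(** The rows of the incidence matrix [N] are independent: if [u *m N = 0], then multiplying by [N^T]
    gives [u_j * (r - l) + s * l = 0] with [s] the sum of the entries of [u]. Summing over [j]
    yields [s = 0], hence [u = 0]. *)
Lemma fisher (T : finType) (B : {set {set T}}) (r l : nat) :
  (forall x, #|[set b in B | x \in b]| = r) ->
  (forall x y, x != y -> #|[set b in B | (x \in b) && (y \in b)]| = l) ->
  l < r -> #|T| <= #|B|.
Proof.
move=> degr deg2 lt_lr; pose n := #|T|.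
pose pt (i : 'I_n) : T := enum_val i; pose bl (j : 'I_#|B|) : {set T} := enum_val j.
pose N : 'M[rat]_(n, #|B|) := (\matrix_(i, j) (pt i \in bl j)%:R)%R.
suff /eqP rN : row_free N by rewrite -[#|T|]/n -rN rank_leq_col.
apply: inj_row_free => u uN; pose s := (\sum_i u 0 i)%R.
have NNT i j : ((N *m N^T) i j = (if i == j then r else l)%:R)%R.
  rewrite mxE; under eq_bigr => t _ do rewrite !mxE -natrM mulnb.
  rewrite -natr_sum; congr (_%:R)%R.
  have -> : (if i == j then r else l) = #|[set b in B | (pt i \in b) && (pt j \in b)]|.
    case: eqVneq => [-> | ne]; last by rewrite deg2 // (inj_eq enum_val_inj).
    by rewrite -(degr (pt j)); apply: eq_card => b; rewrite !inE andbb.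
  transitivity (\sum_(b in B) ((pt i \in b) && (pt j \in b)))%N.
    by rewrite [RHS]big_enum_val.
  rewrite -[RHS]sum1_card [RHS]big_mkcond [LHS]big_mkcond /=.
  by apply: eq_bigr => b _; rewrite inE; case: (b \in B) => //=; case: (_ && _).
have uNN j : (u 0 j * (r - l)%:R + s * l%:R = 0)%R.
  have /matrixP/(_ 0%R j) : (u *m N *m N^T = 0)%R by rewrite uN mul0mx.
  rewrite -mulmxA !mxE => <-; rewrite (bigD1 j) //= NNT eqxx.
  rewrite /s (bigD1 j) //= mulrDl addrA -mulrDr -natrD subnK 1?ltnW //.
  congr (_ + _)%R; rewrite mulr_suml; apply: eq_bigr => i ne.
  by rewrite NNT (negPf ne).
have s0 : s = 0%R.
  have : (s * ((r - l) + n * l)%:R = 0)%R.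
    transitivity (\sum_j (u 0%R j * (r - l)%:R + s * l%:R))%R.
      rewrite big_split /= -mulr_suml sumr_const card_ord -mulr_natr -/s.
      by rewrite natrD natrM; ring.
    by rewrite big1.
  by move/eqP; rewrite mulf_eq0 pnatr_eq0 addn_eq0 subn_eq0 leqNgt lt_lr orbF => /eqP.
apply/rowP=> j; rewrite mxE; have /eqP := uNN j.
rewrite s0 mul0r addr0 mulf_eq0 pnatr_eq0 subn_eq0 leqNgt lt_lr orbF.
by move/eqP.
Qed.

(** * Integer consequences of the counting equations *)

Section Arithmetic.
Local Open Scope ring_scope.
Implicit Types v k l r b c d m x q : int.

(* [x = k - 1 - d m], where [m + 1] is the size of a nonempty intersection of a
   block with a class, satisfies [c x = k - m - 1]; modulo [k] this turns
   [c d r = b k] into a bound for [k]. *)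
Lemma arith_x k l r b c d m :
  1 < c -> 1 < d -> 0 < l -> 0 < m -> 2 < k ->
  r * (k - 1) = l * (c * d - 1) -> b * k = c * d * r -> l * (c - 1) = r * m ->
  c * d <= b ->
  exists x q, [/\ 0 < x, x * m <= l - 1, c * x = k - m - 1, d * m = k - 1 - x
    & k * q = l * (m + 1) * (x + 1) * (m + x + 1)].
Proof.
move=> c1 d1 l0 m0 k2 hr hb hc hv.
have h1 : (c - 1) * (k - 1) = (c * d - 1) * m.
  have : l * ((c - 1) * (k - 1)) = l * ((c * d - 1) * m).
    transitivity (r * m * (k - 1)); first by rewrite -hc; ring.
    by rewrite mulrAC hr; ring.
  by apply/mulfI; lia.
pose x := k - 1 - d * m.
have cx : c * x = k - m - 1.
  by rewrite /x; move: h1; clear; lia.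
have lt_mk : m < k - 1.
  rewrite ltNge; apply/negP => le_km; have : (c - 1) * (k - 1) < (c * d - 1) * (k - 1).
    by rewrite ltr_pM2r; [nia | lia].
  by rewrite h1; nia.
have x0 : 0 < x.
  by rewrite -(pmulr_rgt0 _ (_ : 0 < c)) ?cx; lia.
(* The second witness comes from expanding [x ^+ 2 * m ^+ 2 * b * k = l * (k - (m + 1)) * (k - (1 +
   x)) * (k - (m + 1 + x))]: [k * q] collects the multiples of [k], leaving the constant term. *)
exists x, (l * (k ^+ 2 - (m + 1 + (1 + x) + (m + 1 + x)) * k
  + (m + 1) * (1 + x) + (1 + x) * (m + 1 + x) + (m + 1) * (m + 1 + x))
  - x ^+ 2 * m ^+ 2 * b); split=> //; last first.
- have e : x ^+ 2 * m ^+ 2 * (b * k) =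
      l * ((k - (m + 1)) * (k - (1 + x)) * (k - (m + 1 + x))).
    rewrite hb; transitivity ((c * x) * (d * m) * (x * (r * m))); first by ring.
    have ex : x * (r * m) = l * (k - (m + 1 + x)).
      by rewrite -hc; transitivity (l * (c * x - x)); [ring | rewrite cx; ring].
    have -> : d * m = k - (1 + x) by rewrite /x; ring.
    by rewrite cx ex; ring.
  transitivity (l * (k ^+ 2 - (m + 1 + (1 + x) + (m + 1 + x)) * k
    + (m + 1) * (1 + x) + (1 + x) * (m + 1 + x) + (m + 1) * (m + 1 + x)) * k
    - x ^+ 2 * m ^+ 2 * (b * k)); first by ring.
  by rewrite e; ring.
- by rewrite /x; ring.
have le_kr : k <= r.
  have cd0 : 0 < c * d by nia.
  have : (c * d) * k <= (c * d) * r by rewrite -hb ler_pM2r //; lia.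
  by rewrite ler_pM2l.
(* If [l <= x * m], then [k * m <= r * m = l * (c - 1) <= x * m * (c - 1)], too small for
   [k = c * x + m + 1]. *)
rewrite leNgt; apply/negP => lt_l.
have : k * m <= l * (c - 1) by rewrite hc ler_pM2r.
have -> : k = c * x + m + 1 by rewrite cx; ring.
have : l * (c - 1) <= x * m * (c - 1) by rewrite ler_pM2r; lia.
have : 0 < x * m by apply: mulr_gt0.
have : 0 < m * m by apply: mulr_gt0.
by move: m0; clear; lia.
Qed.

(* Unless [m, x >= 2], a large [k] forces [m x = l - 1], so that [k] divides
   [2 l^2 (l + 1)]; equality is possible only if [l - 1] divides [2]. *)
Lemma arith_bound k l r b c d m x q :
  1 < c -> 1 < d -> 0 < m -> 2 < k -> 0 < x -> x * m <= l - 1 ->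
  c * x = k - m - 1 -> d * m = k - 1 - x ->
  k * q = l * (m + 1) * (x + 1) * (m + x + 1) ->
  b * k = c * d * r -> l * (c - 1) = r * m ->
  [\/ k <= 2 * l ^+ 2 * (l - 1),
      [/\ l = 2, m = 1, c = k - 2, d = k - 2 & (k = 12 \/ k = 24)]
    | [/\ l = 5, m = 2, c = 111, d = 111 & k = 225]].
Proof.
move=> c1 d1 m0 k2 x0 xm cx dm kq hb hc.
have [|big] := leP k (2 * l ^+ 2 * (l - 1)); first by constructor 1.
have l1 : 1 < l by have := mulr_gt0 x0 m0; move: xm; clear; lia.
have l0 : 0 < l by apply: lt_trans l1.
have q0 : 0 < q.
  rewrite -(pmulr_rgt0 _ (_ : 0 < k)) ?kq; last by move: k2; clear; lia.
  by rewrite !mulr_gt0 ?addr_gt0.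
have gt_N : 2 * l * (l - 1) < (m + 1) * (x + 1) * (m + x + 1).
  rewrite -(ltr_pM2l l0) !mulrA.
  apply: lt_le_trans (_ : k * q <= _); last by rewrite kq.
  apply: lt_le_trans (_ : k * 1 <= _); last first.
    by rewrite ler_pM2l; [move: q0 | move: k2]; clear; lia.
  rewrite mulr1; apply: le_lt_trans big; rewrite le_eqVlt; apply/orP; left.
  by apply/eqP; ring.
have le_q z : k * q = z -> z < 2 * k -> q = 1.
  move=> <-; rewrite mulrC ltr_pM2r; last by move: k2; clear; lia.
  by move: q0; clear; lia.
have [/andP[m2 x2] | small] := boolP ((2 <= m) && (2 <= x)).
  have le_s : 2 * (m + x) <= x * m + 4.
    have : 0 <= (m - 2) * (x - 2) by rewrite mulr_ge0 ?subr_ge0.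
    by clear; lia.
  (* For [P = x * m >= 5], four times the right side of [gt_N] is at most [(3 * P + 6) * (P + 6)] by
     [le_s], and four times the left side is at least [8 * P * (P + 1)], which is no smaller. *)
  have P5 : x * m < 5.
    rewrite ltNge; apply/negP => P_ge.
    have : (2 * (x * m + m + x + 1)) * (2 * (m + x + 1)) <=
        (3 * (x * m) + 6) * (x * m + 6).
      by apply: ler_pM; move: le_s P_ge m2 x2; clear; lia.
    have : (x * m + 1) * (x * m) <= l * (l - 1).
      by apply: ler_pM; move: xm P_ge; clear; lia.
    have : 5 * (x * m) <= (x * m) * (x * m).
      by rewrite ler_pM2r //; move: P_ge; clear; lia.
    by move: gt_N P_ge; clear; lia.
  have [em ex] : m = 2 /\ x = 2.
    by move: P5 m2 x2; clear; nia.
  subst m x; have el : l = 5.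
    have : l < 6.
      rewrite ltNge; apply/negP => l6; have : 6 * l <= l * l.
        by rewrite ler_pM2r.
      by move: gt_N l6; clear; lia.
    by move: xm; clear; lia.
  subst l; constructor 3.
  have q1 : q = 1 by apply: (le_q _ kq); move: big; clear; lia.
  by subst q; split=> //; move: kq cx dm; clear; lia.
have ew w : 0 < w -> w <= l - 1 ->
    2 * l * (l - 1) < 2 * (w + 1) * (w + 2) -> w = l - 1.
  move=> w0 le_w; apply: contraTeq => ne; rewrite -leNgt.
  have : (w + 1) * (w + 2) <= (l - 1) * l.
    by apply: ler_pM; move: w0 le_w ne; clear; lia.
  by clear; lia.
have kq2 : k * q = 2 * (l ^+ 2 * (l + 1)) /\
    [\/ m = 1 /\ x = l - 1 | x = 1 /\ m = l - 1].
  have [em | ex] : m = 1 \/ x = 1 by move: small m0 x0; clear; lia.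
    have ex : x = l - 1.
      by apply: ew => //; move: xm gt_N; rewrite em; clear; lia.
    by split; [rewrite kq em ex; ring | constructor 1].
  have em : m = l - 1.
    by apply: ew => //; move: xm gt_N; rewrite ex; clear; lia.
  by split; [rewrite kq em ex; ring | constructor 2].
case: kq2 => {}kq mx.
have [l2 | l3] : l = 2 \/ 3 <= l by move: l1; clear; lia.
  have [em ex] : m = 1 /\ x = 1 by move: mx; rewrite l2; clear; lia.
  constructor 2; subst l m x; split=> //; [move: cx|move: dm|].
  - by clear; lia.
  - by clear; lia.
  have k8 : 8 < k by move: big; clear; lia.
  have : q < 3.
    rewrite ltNge; apply/negP => q3.
    have : k * 3 <= k * q by rewrite ler_pM2l //; move: k2; clear; lia.
    by rewrite kq; move: k8; clear; lia.
  move=> q3; have [e | e] : q = 1 \/ q = 2 by move: q0 q3; clear; lia.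
    by move: kq; rewrite e; clear; lia.
  by move: kq; rewrite e; clear; lia.
have q1 : q = 1.
  apply: (le_q _ kq); have : 0 <= l ^+ 2 * (l - 3).
    by rewrite mulr_ge0 ?exprn_ge0 ?subr_ge0 // ltW.
  by move: big; clear; lia.
have ek : k = 2 * (l ^+ 2 * (l + 1)) by rewrite -kq q1 mulr1.
have [t et] : exists t : int, t * (l - 1) = k - 2.
  case: mx => -[e1 e2]; first by exists c; rewrite -e2 cx e1; clear; lia.
  by exists d; rewrite -e2 dm e1; clear; lia.
(* Dividing [k - 2] by [l - 1] gives the quotient [2 * l ^+ 2 + 4 * l + 4] and remainder [2]. *)
have l3' : l = 3.
  have : (l - 1) * (t - (2 * l ^+ 2 + 4 * l + 4)) = 2 .
    rewrite mulrBr mulrC et ek; ring.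
  move: (t - _) => t' e; have l1' : 0 < l - 1 by move: l3; clear; lia.
  have t'0 : 0 < t' by rewrite -(pmulr_rgt0 _ l1') e.
  have : (l - 1) * 1 <= (l - 1) * t' by rewrite ler_pM2l //; move: t'0; clear; lia.
  by rewrite e; move: l3; clear; lia.
(* Now [k = 72], [c] and [d] are [35] and [69] in some order, and [r = 102]; but [72] does not
   divide [35 * 69 * 102]. *)
move: ek; rewrite l3' => ek.
by case: mx => -[e1 e2]; move: cx dm hb hc; rewrite ek e1 e2 l3'; clear; nia.
Qed.
End Arithmetic.

(** * From the design to its parameters *)

Section Bound.

Local Open Scope group_scope.

Variables (T : finType) (B Q : {set {set T}}) (G : {group {perm T}}).
Variables (v k lam : nat).
Hypotheses (desB : is_2design B v k lam) (parB : nontrivial_params v k)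
  (actB : design_automorphism_group B G) (ftG : flag_transitive B G)
  (partQ : partition Q [set: T]) (actQ : [acts G, on Q | 'P^*])
  (Qsing : Q != [set [set x] | x : T]) (Qfull : Q != [set [set: T]]).

Lemma imprimitive_design_bound :
  (k%:Z <= 2 * lam%:Z ^+ 2 * (lam%:Z - 1))%R /\ (v <= (k - 2) ^ 2)%N.
Proof.
have [cT card_block deg2] := desB; have /andP[k2 lt_kv] := parB.
have /imsetP[[x0 b0] fl0 _] := ftG.
have [Bb0 b0x0] : b0 \in B /\ x0 \in b0 by move: fl0; rewrite inE => /andP[].
have lam_gt0 : 0 < lam.
  have /card_gt0P[y /setD1P[ne b0y]] : 0 < #|b0 :\ x0|.
    have := cardsD1 x0 b0; rewrite b0x0 (card_block _ Bb0).
    by move: #|_| => n; move: k2; clear; lia.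
  rewrite -(deg2 _ _ ne); apply/card_gt0P; exists b0.
  by rewrite inE Bb0 b0y b0x0.
pose deg x := #|[set b in B | x \in b]|.
have degE x : (deg x * k.-1 = v.-1 * lam)%N.
  have -> : v.-1 = #|[set: T] :\ x|.
    by have := cardsD1 x [set: T]; rewrite inE cardsT cT => ->.
  apply/esym; apply: (double_count (R := fun y (b : {set T}) => y \in b)) => [y|b].
    rewrite !inE andbT => ne; rewrite -(@deg2 x y) 1?eq_sym //.
    by apply: eq_card => b; rewrite !inE andbA.
  rewrite inE => /andP[Bb bx]; rewrite -(card_block _ Bb) (cardsD1 x b) bx /=.
  by apply: eq_card => y; rewrite !inE andbT.
pose r := deg x0; have deg1 x : deg x = r.
  apply/eqP; rewrite -(eqn_pmul2r (_ : 0 < k.-1)); last by move: k2; clear; lia.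
  by rewrite !degE.
have r_gt0 : 0 < r by apply/card_gt0P; exists b0; rewrite inE Bb0.
have lt_lam_r : lam < r.
  have := degE x0; rewrite -/r => e; rewrite ltnNge; apply/negP => le_r.
  have : (r * k.-1 <= lam * k.-1)%N by rewrite leq_mul2r le_r orbT.
  have : (lam * k.-1 < v.-1 * lam)%N.
    by rewrite mulnC ltn_pmul2r //; move: k2 lt_kv; clear; lia.
  by rewrite e; clear; lia.
have eB : (#|B| * k = v * r)%N.
  rewrite -cT -cardsT; apply/esym.
  apply: (double_count (R := fun y (b : {set T}) => y \in b)) => [y _|b Bb].
    exact: deg1.
  by rewrite -(card_block _ Bb); apply: eq_card => y; rewrite !inE.
have covQ x : x \in cover Q by case/and3P: partQ => /eqP->; rewrite inE.
have trivQ : trivIset Q by case/and3P: partQ.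
have trP := trans_points deg1 ftG r_gt0.
pose c := #|pblock Q x0|; pose d := #|Q|.
have card_cls x : #|pblock Q x| = c.
  have [g Gg ->] := atransP2 trP (in_setT x0) (in_setT x).
  by rewrite (clsJ partQ actQ) // card_setact.
have card_class D : D \in Q -> #|D| = c.
  move=> QD; have /set0Pn[x Dx] : D != set0.
    by apply: contraTneq QD => ->; case/and3P: partQ.
  by rewrite -(card_cls x) (def_pblock trivQ QD Dx).
pose l := #|b0 :&: pblock Q x0|.
have card_meet b D x : b \in B -> D \in Q -> x \in b -> x \in D -> #|b :&: D| = l.
  move=> Bb QD bx Dx; rewrite -(def_pblock trivQ QD Dx).
  have [g Gg [<- <-]] := flag_trans ftG Bb0 b0x0 Bb bx.
  by rewrite (clsJ partQ actQ) // -setact_setI card_setact.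
have c_gt1 : 1 < c.
  rewrite ltnNge; apply: contra Qsing => c1; apply/eqP/setP=> D.
  have Ex x : pblock Q x = [set x].
    by apply/esym/eqP; rewrite eqEcard sub1set mem_pblock covQ cards1 card_cls.
  apply/idP/imsetP => [QD | [x _ ->]]; last by rewrite -Ex pblock_mem.
  have /set0Pn[x Dx] : D != set0.
    by apply: contraTneq QD => ->; case/and3P: partQ.
  by exists x; rewrite // -Ex (def_pblock trivQ QD Dx).
have d_gt1 : 1 < d.
  have QD := pblock_mem (covQ x0).
  rewrite ltnNge; apply: contra Qfull => d1; apply/eqP/setP=> D.
  have e1 E : E \in Q -> E = pblock Q x0 by move=> QE; apply: (card_le1_eqP d1).
  have eT : pblock Q x0 = [set: T].
    by apply/setP=> y; rewrite inE -(e1 _ (pblock_mem (covQ y))) mem_pblock covQ.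
  by rewrite inE -eT; apply/idP/eqP => [/e1 | ->].
have eL : (c.-1 * lam = r * l.-1)%N.
  have -> : c.-1 = #|pblock Q x0 :\ x0|.
    by rewrite /c (cardsD1 x0) mem_pblock covQ.
  apply: (double_count (R := fun y (b : {set T}) => y \in b)) => [y /setD1P[ne _]|b].
    rewrite -(@deg2 x0 y) 1?eq_sym //.
    by apply: eq_card => b; rewrite !inE andbA.
  rewrite inE => /andP[Bb bx].
  have Dx : x0 \in pblock Q x0 by rewrite mem_pblock covQ.
  have := cardsD1 x0 (b :&: pblock Q x0).
  rewrite (card_meet b _ x0 Bb (pblock_mem (covQ x0)) bx Dx) in_setI bx Dx.
  rewrite add1n => -> /=; apply: eq_card => y.
  by rewrite !inE -andbA; congr (_ && _); rewrite andbC.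
have l_gt1 : 1 < l.
  rewrite ltnNge; apply/negP => l1; have l0 : l.-1 = 0 by move: l1; clear; lia.
  have : 0 < (c.-1 * lam)%N by rewrite muln_gt0 lam_gt0 andbT; move: c_gt1; clear; lia.
  by rewrite eL l0 muln0.
have lt_lc : l < c.
  rewrite ltnNge; apply/negP => le_c.
  have : (c.-1 * lam < r * l.-1)%N; last by rewrite eL ltnn.
  rewrite mulnC; apply: leq_trans (_ : r * c.-1 <= _)%N.
    by rewrite ltn_pmul2r //; move: c_gt1; clear; lia.
  by rewrite leq_mul2l; apply/orP; right; move: le_c; clear; lia.
have ev : v = (c * d)%N by rewrite -cT; apply: card_points partQ card_class erefl.
have le_vB : v <= #|B|.
  by rewrite -cT; apply: (fisher (r := r) (l := lam)).
have eB' : (#|B| * k = c * d * r)%N by rewrite eB ev.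
(* The exceptions [k = 12] and [k = 24] are [2 * p + 2] for [p = 5] and [p = 11]. *)
have pair p : p = 5 \/ p = 11 -> k = (2 * p + 2)%N -> lam = 2 -> l = 2 ->
    c = (2 * p)%N -> d = (2 * p)%N -> False.
  move=> ep ek elam el ec ed.
  apply: (pair_false card_block deg2 deg1 actB ftG partQ actQ card_class erefl
    card_meet lam_gt0 r_gt0 l_gt1 lt_lc d_gt1 ep ek elam _ el ec ed eB').
  by move: eL; rewrite elam el ec muln1; clear; lia.
have triple : k = 225 -> lam = 5 -> l = 3 -> c = 111 -> d = 111 -> False.
  move=> ek elam el ec ed.
  apply: (triple_false card_block deg2 deg1 actB ftG partQ actQ card_class erefl
    card_meet lam_gt0 r_gt0 l_gt1 lt_lc d_gt1 ek elam _ el ec ed eB').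
  by move: eL; rewrite elam el ec; clear; lia.
have hr : (r%:Z * (k%:Z - 1) = lam%:Z * (c%:Z * d%:Z - 1))%R.
  have := degE x0; rewrite -/r ev.
  have := ltn_trans k2 lt_kv; rewrite ev; case: (k) k2 => // k' _.
  by move: (c * d)%N (PoszM c d) => [|n] //; clear; lia.
have hl : (lam%:Z * (c%:Z - 1) = r%:Z * (l%:Z - 1))%R.
  by move: eL; case: (c) c_gt1 => // c' _; case: (l) l_gt1 => // l' _; clear; lia.
have hB : (#|B|%:Z * k%:Z = c%:Z * d%:Z * r%:Z)%R by rewrite -!PoszM eB'.
have hv : (c%:Z * d%:Z <= #|B|%:Z)%R by rewrite -PoszM -ev lez_nat.
have l1 : (0 < l%:Z - 1 :> int)%R by move: l_gt1; clear; lia.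
(* The variables [l] and [m] of [arith_x] are here [lam] and [l - 1]. *)
have [x [q [x0' xm cx dm kq]]] :=
  @arith_x k lam r #|B| c d (l%:Z - 1)%R c_gt1 d_gt1 lam_gt0 l1 k2 hr hB hl hv.
split; last first.
  (* As [x] and [l - 1] are positive, [d <= d * (l - 1) = k - 1 - x] and [c <= c * x = k - l], both
     at most [k - 2]. *)
  rewrite ev expnS expn1; apply: leq_mul; last first.
    have : (d%:Z * 1 <= d%:Z * (l%:Z - 1))%R.
      by rewrite ler_pM2l //; move: l1 d_gt1; clear; lia.
    by rewrite dm; move: x0'; clear; lia.
  have : (c%:Z * 1 <= c%:Z * x)%R by rewrite ler_pM2l //; move: x0' c_gt1; clear; lia.
  by rewrite cx; move: l1; clear; lia.
have [// | [elam el ec ed [ek | ek]] | [elam el ec ed ek]] :=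
  @arith_bound k lam r #|B| c d (l%:Z - 1)%R x q c_gt1 d_gt1 l1 k2 x0' xm
    cx dm kq hB hl.
- by case: (pair 5); rewrite ?ek; move: elam el ec ed ek; clear; lia.
- by case: (pair 11); move: elam el ec ed ek; clear; lia.
by case: triple; move: elam el ec ed ek; clear; lia.
Qed.

End Bound.

Local Open Scope ring_scope.

Theorem theorem1p1 (T : finType) (B : {set {set T}}) (v k lambda : nat)
    (G : {group {perm T}}) :
  is_2design B v k lambda ->
  nontrivial_params v k ->
  design_automorphism_group B G ->
  flag_transitive B G ->
  point_imprimitive G ->
  k%:Z <= 2 * lambda%:Z ^+ 2 * (lambda%:Z - 1) /\
  v%:Z <= (2 * lambda%:Z ^+ 2 * (lambda%:Z - 1) - 2) ^+ 2.
Proof.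
move=> desB parB actB ftG [Q [partQ actQ Qsing Qfull]].
have [le_k le_v] :=
  imprimitive_design_bound desB parB actB ftG partQ actQ Qsing Qfull.
split=> //; have /andP[k2 _] := parB.
apply: le_trans (_ : (k%:Z - 2) ^+ 2 <= _).
  by move: le_v k2; rewrite expnS expn1 expr2; clear; lia.
by rewrite lerXn2r ?nnegrE; move: le_k k2; clear; lia.
Qed.
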